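(* Let $m,n\ge0$ be integers with $m+n\ge1$, let $r\ge1$ and let $\mu=(\mu_1,\dots,\mu_l)\vdash r$ be a partition with $l=l(\mu)$ (nonzero) parts. Then $$\frac{q^{|\mu|}}{(q-q^{-1})^{l(\mu)}}\,q_{\mu}(x/y;q^{-2})=\sum_{\lambda\vdash r}\chi^{\lambda}(T_{\gamma_\mu})\,s_{\lambda}(x/y),$$ where $\chi^\lambda$ is the irreducible character of the Iwahori-Hecke algebra $\mathscr{H}_q=\mathscr{H}_{K',r}(q)$ corresponding to $\lambda$.
   Context: Here $q,x_1,\dots,x_m,y_1,\dots,y_n$ are algebraically independent indeterminates over $\mathbb{Q}$, and $K'=\mathbb{Q}(q)(x_1,\dots,x_m,y_1,\dots,y_n)$. $\mathscr{H}_{K',r}(q)$ is the $K'$-algebra generated by $T_1,\dots,T_{r-1}$ with relations $T_i^2=(q-q^{-1})T_i+1$; $T_iT_{i+1}T_i=T_{i+1}T_iT_{i+1}$; $T_iT_j=T_jT_i$ if $|i-j|>1$. It is split semisimple, with irreducible characters $\chi^\lambda$ indexed by partitions $\lambda\vdash r$; $\chi^\lambda$ is the one whose values on the standard basis elements $T_\sigma$ ($\sigma\in\mathfrak{S}_r$) lie in $\mathbb{Z}[q,q^{-1}]$ and specialize at $q=1$ to the irreducible character of the symmetric group $\mathfrak{S}_r$ indexed by $\lambda$ (with $\lambda=(r)$ giving the trivial character). For $\mu=(\mu_1,\dots,\mu_l)\vdash r$, $\gamma_\mu=\gamma_{\mu_1}\cdots\gamma_{\mu_l}$ where $\gamma_{\mu_i}$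 is the cycle $(a_i+1\ \ a_i+2\ \cdots\ a_i+\mu_i)$ with $a_i=\mu_1+\cdots+\mu_{i-1}$, and $T_{\gamma_\mu}=T_{\gamma_{\mu_1}}\cdots T_{\gamma_{\mu_l}}$ with $T_{\gamma_{\mu_i}}=T_{a_i+1}T_{a_i+2}\cdots T_{a_i+\mu_i-1}$ (equal to $1$ if $\mu_i=1$). Supersymmetric Schur functions: define $e_k(x/y)$ by $\sum_{k\ge0}e_k(x/y)t^k=\prod_{i=1}^m(1+x_it)\big/\prod_{j=1}^n(1+y_jt)$, with $e_k(x/y)=0$ for $k<0$. For a partition $\lambda$ with conjugate $\lambda'$ and $l'=l(\lambda')$, $s_\lambda(x/y)=\det\big(e_{\lambda'_i-i+j}(x/y)\big)_{1\le i,j\le l'}$. The supersymmetric functions $q_k(x/y;q)$ are defined by $\sum_{k\ge0}q_k(x/y;q)u^k=\prod_{i=1}^m\frac{1-x_iqu}{1-x_iu}\prod_{j=1}^n\frac{1-y_ju}{1-y_jqu}$, and $q_\mu(x/y;q)=\prod_{i=1}^{l(\mu)}q_{\mu_i}(x/y;q)$; the parameter $q$ is replaced by $q^{-2}$ in $q_\mu(x/y;q^{-2})$. *)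

(* Defs.v *)
From HB Require Import structures.
From mathcomp Require Import all_boot all_order all_algebra all_fingroup.
From mathcomp Require Import all_solvable all_field all_character.
From mathcomp Require Import mpoly.

Set Implicit Arguments.
Unset Strict Implicit.
Unset Printing Implicit Defensive.

Import Order.TTheory GRing.Theory Num.Theory.
Local Open Scope ring_scope.

Definition is_intpart (r : nat) (s : seq nat) : bool :=
  [&& sorted geq s, 0%N \notin s & sumn s == r].

Structure intpart (r : nat) : Type :=
  IntPart { intpart_val :> seq nat; _ : is_intpart r intpart_val }.

HB.instance Definition _ r := [isSub for @intpart_val r].
HB.instance Definition _ r := [Countable of intpart r by <:].

Section IntPartFinite.
Variable r : nat.

Lemma intpart_bounded (la : intpart r) :
  (size la <= r)%N && all (fun k => (k < r.+1)%N) la.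
Proof.
case: la => s /= /and3P[_ s0 /eqP <-]; elim: s s0 => //= a s IHs.
rewrite inE negb_or eq_sym -lt0n => /andP[a_gt0 /IHs /andP[sz_s /allP s_le]].
rewrite -add1n leq_add //= ltnS leq_addr /=; apply/allP => k /s_le.
by rewrite !ltnS => /leq_trans; apply; rewrite leq_addl.
Qed.

Definition intpart_code (la : intpart r) : r.-bseq 'I_r.+1 :=
  insub_bseq r [seq inord k | k <- la].

Definition intpart_decode (b : r.-bseq 'I_r.+1) : option (intpart r) :=
  insub [seq val i | i <- b].

Lemma intpart_codeK : pcancel intpart_code intpart_decode.
Proof.
move=> la; have /andP[sz_la /allP le_la] := intpart_bounded la.
rewrite /intpart_decode /intpart_code /insub_bseq insubdK; last first.
  by rewrite unfold_in size_map.
rewrite -map_comp (_ : map _ _ = la) ?valK //.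
by rewrite -[RHS]map_id; apply/eq_in_map => k /le_la; apply: inordK.
Qed.

HB.instance Definition _ : isFinite (intpart r) :=
  PCanIsFinite intpart_codeK.

End IntPartFinite.

Definition conj_part (s : seq nat) : seq nat :=
  [seq count (fun k => (j < k)%N) s | j <- iota 0 (head 0%N s)].

Section SymmetricCharacters.
Variable r : nat.

(* The permutations of {0, ..., r-1} preserving each of the consecutive
   intervals of lengths s_0, s_1, ... *)
Definition young_set (s : seq nat) : {set 'S_r} :=
  [set g : 'S_r | [forall k, reshape_index s (g k) == reshape_index s k]].

Lemma young_group_set s : group_set (young_set s).
Proof.
apply/group_setP; split=> [|g h].
  by rewrite inE; apply/forallP => k; rewrite perm1.
rewrite !inE => /forallP gP /forallP hP; apply/forallP => k.
by rewrite permM (eqP (hP _)).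
Qed.

Canonical young_group (s : seq nat) : {group 'S_r} := Group (young_group_set s).

Lemma sign_class_fun (G : {group 'S_r}) :
  is_class_fun <<G>>%g
    [ffun g : 'S_r => if g \in G then (-1) ^+ odd_perm g else 0].
Proof.
rewrite genGid; apply: intro_class_fun => [g h Gg Gh | g /negbTE-> //].
by rewrite groupJ // Gg odd_permJ.
Qed.

Definition cfsign (G : {group 'S_r}) : 'CF(G) := Cfun 0 (sign_class_fun G).

(* The irreducible character indexed by la is the unique (multiplicity one)
   common constituent of the permutation character on the Young subgroup of la
   and of the sign character induced from the Young subgroup of the conjugate
   partition; it is the character of the Specht module of la, and it is the
   trivial character for la = (r). *)
Definition sym_Iirr (la : intpart r) : Iirr [set: 'S_r] :=
  odflt 0
    [pick i | (i \in irr_constt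
                 ('Ind[[set: 'S_r], young_group la] 1))
           && (i \in irr_constt
                 ('Ind[[set: 'S_r], young_group (conj_part la)] (cfsign _)))].

Lemma succ_adj_subproof (i : 'I_r.-1) : (i.+1 < r)%N.
Proof. by case: i => i /=; case: r. Qed.

Definition adj_transp (i : 'I_r.-1) : 'S_r :=
  tperm (widen_ord (leq_pred r) i) (Ordinal (succ_adj_subproof i)).

(* s_{w_1} o s_{w_2} o ... o s_{w_k}, as a composite of functions; the product
   of {perm _} composes in the opposite order. *)
Definition word_perm (w : seq 'I_r.-1) : 'S_r :=
  foldr (fun i g => (g * adj_transp i)%g) 1%g w.

Definition reduced_word (w : seq 'I_r.-1) (g : 'S_r) : Prop :=
  word_perm w = g /\
  forall w' : seq 'I_r.-1, word_perm w' = g -> (size w <= size w')%N.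

End SymmetricCharacters.

(* Indices are 0-based: T i is the generator usually written T_{i+1}, and lifts
   the transposition of i and i + 1 in {0, ..., r-1}. *)

Section Hecke.
Variables (K : fieldType) (q : K) (r : nat).

Definition hecke_relations (A : algType K) (T : 'I_r.-1 -> A) : Prop :=
  [/\ forall i, T i ^+ 2 = (q - q^-1) *: T i + 1,
      forall i j : 'I_r.-1, j = i.+1 :> nat ->
        T i * T j * T i = T j * T i * T j
    & forall i j : 'I_r.-1, (i.+1 < j)%N || (j.+1 < i)%N ->
        T i * T j = T j * T i].

Definition is_hecke_algebra (H : algType K) (T : 'I_r.-1 -> H) : Prop :=
  hecke_relations T /\
  forall (A : algType K) (T' : 'I_r.-1 -> A), hecke_relations T' ->
    exists f : {lrmorphism H -> A},
      (forall i, f (T i) = T' i) /\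
      (forall g : {lrmorphism H -> A}, (forall i, g (T i) = T' i) -> g =1 f).

Variables (H : algType K) (T : 'I_r.-1 -> H).

(* Row-vector convention of mxrepresentation: U ranges over the subspaces of
   K^(d+1), given as row spaces, and H acts by right multiplication. *)
Definition irreducible_rep (d : nat) (rho : H -> 'M[K]_d.+1) : Prop :=
  forall U : 'M[K]_d.+1,
    (forall h, (U *m rho h <= U)%MS) -> U != 0 -> row_full U.

Definition is_irr_char (chi : H -> K) : Prop :=
  exists (d : nat) (rho : {lrmorphism H -> 'M[K]_d.+1}),
    irreducible_rep rho /\ forall h, chi h = \tr (rho h).

(* T_g is the product of the generators along any reduced word of g; its value
   p(q) / q^k under chi is a Laurent polynomial, whose value at q = 1 is the sum
   of the coefficients of p.  This determines p(1) when q is transcendental. *)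
Definition is_hecke_irr_char (la : intpart r) (chi : H -> K) : Prop :=
  is_irr_char chi /\
  forall (g : 'S_r) (w : seq 'I_r.-1), reduced_word w g ->
    exists (p : {poly int}) (k : nat),
      chi (\prod_(i <- w) T i) = (map_poly intr p).[q] / q ^+ k /\
      (p.[1])%:~R = 'chi_(sym_Iirr la) g.

(* T_{a+1} T_{a+2} ... T_{a+b-1} in 1-based notation; the ordered product over
   'I_r.-1 is in increasing order. *)
Definition hecke_cycle (a b : nat) : H :=
  \prod_(k < r.-1 | (a <= k < a + b.-1)%N) T k.

Definition hecke_gamma (mu : seq nat) : H :=
  \prod_(0 <= i < size mu) hecke_cycle (sumn (take i mu)) (nth 0%N mu i).

End Hecke.

Section PowerSeriesQuotient.
Variables (K : fieldType) (P Q : {poly K}).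

Fixpoint series_quot_seq (k : nat) : seq K :=
  if k is k'.+1 then
    let s := series_quot_seq k' in
    rcons s ((P`_k' - \sum_(i < k') Q`_(k' - i) * s`_i) / Q`_0)
  else [::].

(* The coefficient of degree k of the power series P / Q, when Q`_0 != 0. *)
Definition series_quot (k : nat) : K := (series_quot_seq k.+1)`_k.

Lemma size_series_quot_seq k : size (series_quot_seq k) = k.
Proof. by elim: k => //= k IHk; rewrite size_rcons IHk. Qed.

Lemma nth_series_quot_seq k i :
  (i < k)%N -> (series_quot_seq k)`_i = series_quot i.
Proof.
elim: k => // k IHk; rewrite ltnS leq_eqVlt => /predU1P[-> // | lt_ik].
by rewrite /= nth_rcons size_series_quot_seq lt_ik IHk.
Qed.

Lemma series_quotP k :
  Q`_0 != 0 -> \sum_(i < k.+1) Q`_(k - i) * series_quot i = P`_k.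
Proof.
move=> Q0; rewrite big_ord_recr /= subnn {2}/series_quot /=.
rewrite nth_rcons size_series_quot_seq ltnn eqxx mulrCA divff // mulr1.
rewrite addrC -[RHS](subrK (\sum_(i < k) Q`_(k - i) * series_quot i)).
congr (_ - _ + _); apply: eq_bigr => i _.
by rewrite nth_series_quot_seq.
Qed.

End PowerSeriesQuotient.

Section SuperSymmetric.
Variables (K : fieldType) (m n : nat) (x : 'I_m -> K) (y : 'I_n -> K).

Definition super_e (k : nat) : K :=
  series_quot (\prod_(i < m) (1 + (x i)%:P * 'X))
              (\prod_(j < n) (1 + (y j)%:P * 'X)) k.

Definition super_e_int (k : int) : K :=
  match k with Posz k' => super_e k' | Negz _ => 0 end.

Definition super_schur (la : seq nat) : K :=
  let la' := conj_part la in
  \det (\matrix_(i < size la', j < size la')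
          super_e_int ((nth 0%N la' i)%:Z - i%:Z + j%:Z)).

Definition super_q (c : K) (k : nat) : K :=
  series_quot
    ((\prod_(i < m) (1 - (x i * c)%:P * 'X)) *
     (\prod_(j < n) (1 - (y j)%:P * 'X)))
    ((\prod_(i < m) (1 - (x i)%:P * 'X)) *
     (\prod_(j < n) (1 - (y j * c)%:P * 'X))) k.

Definition super_q_part (c : K) (mu : seq nat) : K :=
  \prod_(k <- mu) super_q c k.

End SuperSymmetric.

Definition Qq : fieldType := {fraction {poly rat}}.

Definition Kxy (m n : nat) : fieldType := {fraction {mpoly Qq[m + n]}}.

Definition Kxy_q (m n : nat) : Kxy m n :=
  FracField.tofrac ((FracField.tofrac ('X : {poly rat}) : Qq)%:MP_[m + n]).

Definition Kxy_x (m n : nat) (i : 'I_m) : Kxy m n :=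
  FracField.tofrac ('X_(lshift n i) : {mpoly Qq[m + n]}).

Definition Kxy_y (m n : nat) (j : 'I_n) : Kxy m n :=
  FracField.tofrac ('X_(rshift m j) : {mpoly Qq[m + n]}).

(* Main.v *)
Require Import Defs.
From HB Require Import structures.
From mathcomp Require Import all_boot all_order all_algebra all_fingroup.
From mathcomp Require Import all_solvable all_field all_character.
From mathcomp Require Import mpoly zify ring.
(** Both sides are values of trace functions on the Hecke algebra, and a trace
function is determined by its values at the symmetrising idempotents of the
parabolic subalgebras, where irreducible characters take integral values that
can be read off at q = 1.

Let e_k be the idempotent of k consecutive strands, so that
T_i e_k = q e_k = e_k T_i, let gamma_k = T_1 ... T_(k-1), and put
[k] = 1 + q^2 + ... + q^(2k-2).  Let F be linear with F(T_i x) = F(x T_i) for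
all i and x.  Expanding e_(k+1) along representatives of the cosets of S_k in
S_(k+1) and absorbing the generators of S_k into e_k gives
  [k+1] F(G e_(k+1)) = sum_(0 <= j <= k) q^j F(G e_(k-j) gamma_(j+1))
when G commutes with the strands involved ([block_trace_rec]).  If sequences h
and g with h_0 = 1 satisfy [k+1] h_(k+1) = sum_j q^j h_(k-j) g_(j+1), then
F(e_nu) = h_nu for all nu if and only if F(T_(gamma_mu)) = g_mu for all mu
([block_trace_of_idems], [block_trace_of_chains]).  For the trace function
F = sum_la s_la(x/y) chi^la this reduces the theorem to F(e_nu) = h_nu(x/y):
with H(u) = sum_k h_k(x/y) u^k, the generating series of the
q_k(x/y; q^-2) at q^2 u is H(q^2 u) / H(u), so that
g_k = q^k q_k(x/y; q^-2) / (q - q^-1) satisfies the recursion ([super_hg]).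

The number chi^la(e_nu) is the trace of an idempotent matrix, hence a natural
number.  Expanded over the reduced words of the elements of the Young subgroup
S_nu, it is also a quotient of Laurent polynomials in q, defined at q = 1,
and it is therefore equal to its value there, the mean of the character of the
symmetric group over S_nu, that is <chi^la, Ind 1_(S_nu)>
([hecke_char_sym_idems]).

It remains to prove h_nu = sum_la <chi^la, Ind 1_(S_nu)> s_la.  The equivalence
above, applied at q = 1 to the weighted permutation module of colourings of the
points, gives <Ind sgn_(S_ka), Ind 1_(S_nu)> and
<Ind sgn_(S_ka), Ind sgn_(S_nu)> as the coefficients of z^ka in e_nu(z) and
h_nu(z) ([cfdot_sign_triv], [cfdot_sign_sign]).  By the Jacobi-Trudi identity the
alternating sum psi_la of the Ind sgn_(S_ka), with ka_i = la'_i - i + s(i) for s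
in S_r, has norm 1; comparing leading monomials, it has scalar product 1 with
the common constituent of Ind 1_(S_la) and Ind sgn_(S_la').  So
psi_la = chi^la ([det_charE]), and <chi^la, Ind 1_(S_nu)> is the coefficient of
z^(la'+delta) in a_delta(z) e_nu(z).  The expansion of a_delta e_nu in alternants
turns this into e_nu = sum_la <chi^la, Ind 1_(S_nu)> det(h_(la'_i-i+j))
([prod_elem_schur]).  Elementary symmetric polynomials being algebraically
independent, this is an identity about any two sequences related by
(sum_k h_k t^k) (sum_k (-1)^k e_k t^k) = 1; that relation is symmetric in e and
h, which may thus be exchanged and evaluated at x/y ([prod_compl_schur]). *)

Import Order.TTheory GRing.Theory Num.Theory.
Local Open Scope ring_scope.

Set Implicit Arguments.
Unset Strict Implicit.
Unset Printing Implicit Defensive.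

(** * Symmetrising idempotents and trace functions *)

(** The converse algebra, in which right absorption becomes left absorption. *)
HB.instance Definition _ (K : fieldType) (A : algType K) :=
  GRing.Lmodule.copy A^c A.

HB.instance Definition _ (K : fieldType) (A : algType K) :=
  GRing.LSemiModule_isLSemiAlgebra.Build K A^c
    (fun a x y => @scalerAr K A a y x).

HB.instance Definition _ (K : fieldType) (A : algType K) :=
  GRing.LSemiAlgebra_isSemiAlgebra.Build K A^c
    (fun a x y => @scalerAl K A a y x).

Section Symmetrizers.
Variables (K : fieldType) (q : K).

Definition qint (k : nat) : K := \sum_(i < k) q ^+ (2 * i).
Definition qfact (k : nat) : K := \prod_(i < k) qint i.+1.

Lemma qintS k : qint k.+1 = 1 + q ^+ 2 * qint k.
Proof.
rewrite /qint big_ord_recl muln0 expr0 mulr_sumr; congr (_ + _).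
by apply: eq_bigr => i _; rewrite -exprD -mulnS.
Qed.

Section Defs.
Variables (A : algType K) (T : nat -> A).

(** The sum of q^l T_w over the minimal representatives of the cosets of the
symmetric group of the k points from a in that of k + 1 points. *)
Fixpoint coset_sum (a k : nat) : A :=
  if k is k'.+1 then 1 + q *: (T (a + k') * coset_sum a k') else 1.

(** The sum of q^l(w) T_w over the permutations w of the k points from a; the
recursion is the factorisation along a chain of symmetric groups. *)
Fixpoint symmetrizer (a k : nat) : A :=
  if k is k'.+1 then symmetrizer a k' * coset_sum a k' else 1.

Definition hecke_rels (r : nat) : Prop :=
  [/\ forall i, (i.+1 < r)%N -> T i * T i = (q - q^-1) *: T i + 1,
      forall i, (i.+2 < r)%N -> T i * T i.+1 * T i = T i.+1 * T i * T i.+1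
    & forall i j, (i.+1 < j)%N -> (j.+1 < r)%N -> T i * T j = T j * T i].
End Defs.

Lemma hecke_rels_converse (A : algType K) (T : nat -> A) r :
  hecke_rels T r -> hecke_rels (T : nat -> A^c) r.
Proof.
case=> quad braid far; split=> [|i ltir|i j ltij ltjr]; first exact: quad.
- by rewrite /GRing.mul /= !mulrA braid.
- exact/esym/far.
Qed.

Section OneSided.
Variables (A : algType K) (T : nat -> A) (r : nat).
Hypotheses (q0 : q != 0) (relT : hecke_rels T r).
Local Notation R := (coset_sum T).
Local Notation S := (symmetrizer T).

Lemma coset_sum_comm x a k :
  (forall j, (a <= j < a + k)%N -> x * T j = T j * x) -> x * R a k = R a k * x.
Proof.
elim: k => [|k IHk] xT /=; first by rewrite mulr1 mul1r.
rewrite mulrDl mulrDr mulr1 mul1r -scalerAr -scalerAl mulrA xT; last first.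
  by rewrite leq_addr addnS ltnS leqnn.
rewrite -!mulrA IHk // => j /andP[le_aj lt_j].
by rewrite xT // le_aj addnS ltnS ltnW.
Qed.

Lemma symmetrizer_comm x a k :
  (forall j, (a <= j)%N -> (j.+1 < a + k)%N -> x * T j = T j * x) ->
  x * S a k = S a k * x.
Proof.
elim: k => [|k IHk] xT /=; first by rewrite mulr1 mul1r.
rewrite mulrA IHk => [|j le_aj ltj]; last first.
  by rewrite xT // addnS ltnW.
rewrite -!mulrA coset_sum_comm // => j /andP[le_aj ltj].
by rewrite xT // addnS.
Qed.

Lemma T_commute i j : (i.+1 < j)%N || (j.+1 < i)%N -> (i.+1 < r)%N ->
  (j.+1 < r)%N -> T i * T j = T j * T i.
Proof.
have [_ _ far] := relT.
by case/orP=> lt_ij ltir ltjr; [rewrite far | rewrite -far].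
Qed.

(** Only the absorption by z of the generators below a + k - 1 is available, so the
statement is about z * R and not about R.  The induction passes from z to z * t,
which absorbs one generator less, t being the last generator. *)
Lemma coset_sum_absorb a k z :
    (a + k < r)%N ->
    (forall j, (a <= j)%N -> (j.+1 < a + k)%N -> z * T j = q *: z) ->
  forall i, (a <= i < a + k)%N -> z * R a k * T i = q *: (z * R a k).
Proof.
have [quad braid far] := relT.
elim: k z => [|k IHk] z ltr zT i; first by rewrite addn0 leqNgt andNb.
rewrite addnS ltnS in ltr zT * => /andP[le_ai]; rewrite leq_eqVlt.
set t := T (a + k); case/predU1P=> [{i le_ai}-> | lt_i]; last first.
  have ztT j : (a <= j)%N -> (j.+1 < a + k)%N -> z * t * T j = q *: (z * t).
    move=> le_aj ltj; rewrite -mulrA (T_commute (i := a + k)) ?ltj ?orbT //.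
      by rewrite mulrA zT -?scalerAl // ltnS ltnW.
    by rewrite (leq_trans _ ltr) // ltnS ltnW // ltnW.
  rewrite /= mulrDr mulr1 mulrDl zT ?ltnS //.
  rewrite -!scalerAr -scalerAl mulrA IHk ?le_ai //; last exact: ltnW.
  by rewrite -/t scalerDr.
have tt : t * t = (q - q^-1) *: t + 1.
  by apply: quad; rewrite (leq_trans _ ltr).
have utE u : q *: (u * t * t) = (q ^+ 2 - 1) *: (u * t) + q *: u.
  rewrite -mulrA tt mulrDr mulr1 -scalerAr scalerDr scalerA mulrBr divff //.
rewrite -/t; case: k => [|k] in ltr zT t tt utE IHk *.
  rewrite /= mulr1 mulrDr mulr1 -scalerAr mulrDl -scalerAl utE.
  rewrite scalerBl scale1r addrA [_ + (_ - _)]addrC subrK scalerDr.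
  by rewrite scalerA -expr2 addrC.
set t' := T (a + k).
have tR : t * R a k = R a k * t.
  apply: coset_sum_comm => j /andP[_ ltj].
  apply: T_commute; first by rewrite addnS ltnS ltj orbT.
    by rewrite (leq_trans _ ltr).
  by rewrite (leq_trans _ ltr) // addnS ltnS ltnW // ltnW.
(* z * R a k.+2 = (z + q u) + q^2 v.  Multiplication by t scales z + q u by q because
of the quadratic relation, and v because t t' t = t' t t' and z absorbs t'. *)
set u := z * t; set v := u * t' * R a k.
have vt : v * t = q *: v.
  have braid_t : t * t' * t = t' * t * t'.
    by rewrite /t addnS braid // -addnS (leq_trans _ ltr) // addnS.
  have zt' : z * t' = q *: z by apply: zT; rewrite ?leq_addr ?addnS.
  rewrite /v -mulrA -tR /u -!mulrA (mulrA t') (mulrA t) (mulrA t t') braid_t.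
  by rewrite !mulrA zt' -!scalerAl.
have -> : z * R a k.+2 = z + q *: u + q ^+ 2 *: v.
  rewrite /= -/t -/t' !(mulrDr, mulr1, scalerDr) -!scalerAr !scalerA !mulrA.
  by rewrite -expr2 addrA.
rewrite !mulrDl -!scalerAl vt utE -/u scalerBl scale1r addrA [_ + (_ - _)]addrC.
rewrite subrK !scalerDr !scalerA -expr2 -exprSr -exprS; congr (_ + _).
by rewrite addrC.
Qed.

Lemma symmetrizer_absorb a k : (a + k <= r)%N -> forall i,
  (a <= i)%N -> (i.+1 < a + k)%N -> S a k * T i = q *: S a k.
Proof.
elim: k => [|k IHk] ltr i le_ai; first by rewrite addn0 ltnNge (leqW le_ai).
rewrite addnS ltnS in ltr * => lti.
by rewrite coset_sum_absorb ?le_ai // => j; apply: IHk; apply: ltnW.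
Qed.

Lemma coset_sum_mul z a k :
  (forall i, (a <= i < a + k)%N -> T i * z = q *: z) ->
  R a k * z = qint k.+1 *: z.
Proof.
elim: k => [|k IHk] zT; first by rewrite mul1r /qint big_ord1 expr0 scale1r.
rewrite qintS scalerDl scale1r /= mulrDl mul1r -scalerAl -mulrA IHk; last first.
  by move=> i /andP[le_ai lti]; rewrite zT // le_ai addnS ltnS ltnW.
rewrite -scalerAr zT; first by rewrite !scalerA mulrAC expr2.
by rewrite leq_addr addnS ltnS leqnn.
Qed.

Lemma symmetrizer_mul z a k :
  (forall i, (a <= i)%N -> (i.+1 < a + k)%N -> T i * z = q *: z) ->
  S a k * z = qfact k *: z.
Proof.
elim: k => [|k IHk] zT; first by rewrite mul1r /qfact big_ord0 scale1r.
rewrite /= -mulrA coset_sum_mul => [|i /andP[le_ai lti]]; last first.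
  by rewrite zT // addnS.
rewrite -scalerAr IHk => [|i le_ai lti]; last by rewrite zT // addnS ltnW.
by rewrite scalerA /qfact big_ord_recr mulrC.
Qed.
End OneSided.

Section Blocks.
Variables (A : algType K) (T : nat -> A).
Local Notation S := (symmetrizer T).

Definition sym_idem a k := (qfact k)^-1 *: S a k.
Local Notation e := sym_idem.

Fixpoint chain (a k : nat) : A :=
  if k is k'.+1 then T a * chain a.+1 k' else 1.

Lemma chain_comm x a k :
  (forall j, (a <= j < a + k)%N -> x * T j = T j * x) ->
  x * chain a k = chain a k * x.
Proof.
elim: k a => [|k IHk] a xT /=; first by rewrite mulr1 mul1r.
rewrite mulrA xT ?leqnn ?addnS ?ltnS ?leq_addr // -!mulrA IHk // => j.
by case/andP=> le_aj ltj; rewrite xT // ltnW //= addnS -addSn.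
Qed.

Fixpoint sym_idems (a : nat) (nu : seq nat) : A :=
  if nu is k :: nu' then e a k * sym_idems (a + k) nu' else 1.

Fixpoint chains (a : nat) (mu : seq nat) : A :=
  if mu is k :: mu' then chain a k.-1 * chains (a + k) mu' else 1.

Lemma sym_idems_rcons a nu k :
  sym_idems a (rcons nu k) = sym_idems a nu * e (a + sumn nu) k.
Proof.
elim: nu a => [|l nu IHnu] a /=; first by rewrite mulr1 mul1r addn0.
by rewrite IHnu mulrA addnA.
Qed.

Lemma sym_idem_comm x a k :
  (forall j, (a <= j)%N -> (j.+1 < a + k)%N -> x * T j = T j * x) ->
  x * e a k = e a k * x.
Proof.
by move=> xT; rewrite /e -scalerAr -scalerAl (symmetrizer_comm xT).
Qed.

Lemma sym_idems_comm x a nu :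
  (forall j, (a <= j)%N -> (j.+1 < a + sumn nu)%N -> x * T j = T j * x) ->
  x * sym_idems a nu = sym_idems a nu * x.
Proof.
elim: nu a => [|k nu IHnu] a xT /=; first by rewrite mulr1 mul1r.
rewrite mulrA sym_idem_comm => [|j leaj ltj]; last by rewrite xT //=; lia.
by rewrite -!mulrA IHnu // => j leaj ltj; rewrite xT //=; lia.
Qed.

Lemma chains_comm x a mu :
  (forall j, (a <= j)%N -> (j.+1 < a + sumn mu)%N -> x * T j = T j * x) ->
  x * chains a mu = chains a mu * x.
Proof.
elim: mu a => [|k mu IHmu] a xT /=; first by rewrite mulr1 mul1r.
rewrite mulrA chain_comm => [|j ltj]; last by rewrite xT //=; lia.
by rewrite -!mulrA IHmu // => j leaj ltj; rewrite xT //=; lia.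
Qed.
End Blocks.

Section TwoSided.
Variables (A : algType K) (T : nat -> A) (r : nat).
Hypotheses (q0 : q != 0) (relT : hecke_rels T r).
Hypothesis qint_neq0 : forall k, qint k.+1 != 0.
Local Notation R := (coset_sum T).
Local Notation S := (symmetrizer T).
Local Notation e := (sym_idem T).
Local Notation chain := (chain T).
Local Notation sym_idems := (sym_idems T).
Local Notation chains := (chains T).

Lemma qfact_neq0 k : qfact k != 0.
Proof. by apply/prodf_neq0 => i _. Qed.

(** Reversing all words fixes the symmetriser.  The symmetriser S' of the converse
algebra absorbs on the left and S on the right; evaluating S * S' through the
expansion of either factor gives the same multiple of S' and of S. *)
Lemma symmetrizer_converse a k : (a + k <= r)%N ->
  symmetrizer (T : nat -> A^c) a k = S a k.
Proof.
move=> ler; set S' : A := symmetrizer (T : nat -> A^c) a k.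
have absS := symmetrizer_absorb q0 relT ler.
have absS' := symmetrizer_absorb q0 (hecke_rels_converse relT) ler.
have left_mul : S a k * S' = qfact k *: S'.
  by apply: symmetrizer_mul => i; apply: absS'.
have right_mul : S a k * S' = qfact k *: S a k.
  by apply: (@symmetrizer_mul A^c) => i; apply: absS.
by apply: (@scalerI _ A _ (qfact_neq0 k)); rewrite -right_mul -left_mul.
Qed.

Lemma symmetrizer_absorb_l a k : (a + k <= r)%N -> forall i,
  (a <= i)%N -> (i.+1 < a + k)%N -> T i * S a k = q *: S a k.
Proof.
move=> ler i; rewrite -symmetrizer_converse //.
exact: (symmetrizer_absorb q0 (hecke_rels_converse relT)).
Qed.

Lemma symmetrizer_sqr a k : (a + k <= r)%N -> S a k * S a k = qfact k *: S a k.
Proof. by move=> ler; apply: symmetrizer_mul => i; apply: symmetrizer_absorb_l. Qed.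

Lemma sym_idem_sqr a k : (a + k <= r)%N -> e a k * e a k = e a k.
Proof.
move=> ler; rewrite /e -scalerAr -scalerAl symmetrizer_sqr // !scalerA.
by rewrite divfK ?qfact_neq0.
Qed.

Section Trace.
Variables (B : algType K) (F : {linear A -> B}).
Hypothesis FC : forall i x, (i.+1 < r)%N -> F (T i * x) = F (x * T i).

Lemma trace_coset_sum a k x : (a + k < r)%N ->
  F (R a k * x) = F (x * R a k).
Proof.
elim: k x => [|k IHk] x ltr /=; first by rewrite mulr1 mul1r.
rewrite addnS in ltr; rewrite mulrDl mulrDr mul1r mulr1 !linearD; congr (_ + _).
rewrite -scalerAl -scalerAr !linearZ /= -mulrA FC // -mulrA.
by rewrite IHk ?mulrA // ltnW.
Qed.

(** One step of the expansion of e_(k+1): the term 1 of the coset sum splits off a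
strand, and in the other terms the trace property brings the tail of the coset
word in front of e_k, which absorbs it.  The cycle that starts at the last strand
grows by one at each step. *)
Lemma trace_sym_idem_chain G a k i : (a + k + i < r)%N ->
    (forall j, (a <= j < a + k + i)%N -> G * T j = T j * G) ->
  qint k.+1 *: F (G * e a k.+1 * chain (a + k) i) =
  \sum_(j < k.+1) q ^+ j *: F (G * e a (k - j) * chain (a + (k - j)) (i + j)).
Proof.
elim: k i => [|k IHk] i ltr GT.
  rewrite big_ord1 subn0 expr0 scale1r !addn0.
  by rewrite /e /qfact !big_ord_recl !big_ord0 /= !mulr1 /qint big_ord1 expr0
    invr1 !scale1r.
rewrite big_ord_recl subn0 expr0 scale1r addn0.
have -> : \sum_(j < k.+1) q ^+ bump 0 j *:
      F (G * e a (k.+1 - bump 0 j) * chain (a + (k.+1 - bump 0 j)) (i + bump 0 j))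
  = q *: (qint k.+1 *: F (G * e a k.+1 * chain (a + k) i.+1)).
  have ltr' : (a + k + i.+1 < r)%N by lia.
  have GT' j : (a <= j < a + k + i.+1)%N -> G * T j = T j * G.
    by move=> ltj; apply: GT; lia.
  rewrite IHk //.
  rewrite scaler_sumr; apply: eq_bigr => j _.
  by rewrite /bump /= add1n subSS scalerA -exprS addnS.
have ltk : (a + k.+1 < r)%N by rewrite (leq_ltn_trans _ ltr) ?leq_addr.
have def_e : qint k.+2 *: e a k.+2 =
    e a k.+1 + q *: (e a k.+1 * T (a + k) * R a k).
  rewrite /e /qfact big_ord_recr /= -/(qfact k.+1) invfM scalerA mulrCA divff //.
  rewrite mulr1 -/(S a k.+1) mulrDr mulr1 scalerDr -!scalerAr -!scalerAl.
  by rewrite scalerA mulrC -scalerA !mulrA.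
have R_chain : R a k * chain (a + k.+1) i = chain (a + k.+1) i * R a k.
  apply/esym/coset_sum_comm => j /andP[le_aj ltj]; apply/esym/chain_comm => l.
  case/andP=> lel ltl; apply: (T_commute relT).
  - by rewrite (leq_trans _ lel) // addnS ltnS.
  - by rewrite (leq_ltn_trans _ ltk) // addnS ltnS ltnW.
  - by rewrite (leq_ltn_trans _ ltr).
have R_G : R a k * G = G * R a k.
  apply/esym/coset_sum_comm => j /andP[le_aj ltj]; apply: GT.
  by rewrite le_aj -addnA (leq_trans ltj) // leq_add2l addSn leqW // leq_addr.
have R_e : R a k * e a k.+1 = qint k.+1 *: e a k.+1.
  apply: coset_sum_mul => j /andP[le_aj ltj].
  rewrite /e -scalerAr symmetrizer_absorb_l ?addnS ?ltnS //; last first.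
    by rewrite addnS in ltk; apply: ltnW.
  by rewrite !scalerA mulrC.
rewrite -linearZ /= scalerAl scalerAr def_e mulrDr mulrDl linearD; congr (_ + _).
rewrite -scalerAr -scalerAl [F (_ *: _)]linearZ /=; congr (_ *: _).
rewrite -!mulrA R_chain !mulrA -trace_coset_sum; last first.
  by rewrite (leq_ltn_trans _ ltk) // leq_add2l.
rewrite !mulrA R_G -(mulrA G) R_e -scalerAr -!scalerAl linearZ /=.
by rewrite addnS -!mulrA.
Qed.

(** The value of F at e_nu on the first strands times the cycles of mu on the
following ones. *)
Definition block_trace (nu mu : seq nat) : B :=
  F (sym_idems 0 nu * chains (sumn nu) mu).
Local Notation Phi := block_trace.

Lemma block_trace_rcons0 nu mu : Phi (rcons nu 0) mu = Phi nu mu.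
Proof.
rewrite /Phi sym_idems_rcons sumn_rcons addn0 /e /qfact big_ord0 invr1 scale1r.
by rewrite /= mulr1.
Qed.

Lemma block_trace_rec nu k mu : (sumn nu + k.+1 + sumn mu <= r)%N ->
  qint k.+1 *: Phi (rcons nu k.+1) mu =
  \sum_(j < k.+1) q ^+ j *: Phi (rcons nu (k - j)%N) (j.+1 :: mu).
Proof.
move=> ler; set a := sumn nu.
set Y := sym_idems 0 nu; set Z := chains (a + k.+1) mu.
have YT j : (a <= j)%N -> (j.+1 < r)%N -> Y * T j = T j * Y.
  move=> leaj ltjr; apply/esym/sym_idems_comm => i _ lti.
  by apply: (T_commute relT); lia.
have ZT j : (j < a + k)%N -> Z * T j = T j * Z.
  move=> ltj; apply/esym/chains_comm => i le_i lti.
  by apply: (T_commute relT); lia.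
have YZT j : (a <= j < a + k + 0)%N -> Y * Z * T j = T j * (Y * Z).
  by move=> ltj; rewrite -mulrA ZT ?mulrA ?YT //; lia.
have ltr : (a + k + 0 < r)%N by lia.
have := trace_sym_idem_chain ltr YZT; rewrite /= mulr1 -mulrA sym_idem_comm.
  rewrite /Phi sym_idems_rcons sumn_rcons -/a -/Y !add0n mulrA.
  move=> ->; apply: eq_bigr => j _; congr (_ *: F _).
  rewrite sym_idems_rcons sumn_rcons -/a -/Y !add0n /=.
  have -> : (a + (k - j) + j.+1 = a + k.+1)%N by have := ltn_ord j; lia.
  rewrite -/Z -!mulrA; congr (_ * _); rewrite mulrA sym_idem_comm.
    rewrite -!mulrA; congr (_ * _); apply: chain_comm => i lti.
    by apply: ZT; have := ltn_ord j; lia.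
  by move=> i leai lti; apply: ZT; have := ltn_ord j; lia.
by move=> i leai lti; apply: ZT; lia.
Qed.

Section Evaluate.
Variables h g : nat -> B.
Hypotheses (h0 : h 0 = 1)
  (hg : forall k, (k < r)%N ->
     qint k.+1 *: h k.+1 = \sum_(j < k.+1) q ^+ j *: (h (k - j)%N * g j.+1)).

Let value nu mu := (\prod_(k <- nu) h k) * \prod_(k <- mu) g k.

Let value_rec nu k mu : (k < r)%N ->
  qint k.+1 *: value (rcons nu k.+1) mu =
  \sum_(j < k.+1) q ^+ j *: value (rcons nu (k - j)%N) (j.+1 :: mu).
Proof.
move=> ltkr; rewrite /value big_rcons /= scalerAl scalerAr hg //.
rewrite mulr_sumr mulr_suml; apply: eq_bigr => j _.
rewrite big_rcons big_cons /= -scalerAr -scalerAl; congr (_ *: _).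
by rewrite !mulrA.
Qed.

Let value_rcons0 nu mu : value (rcons nu 0) mu = value nu mu.
Proof. by rewrite /value big_rcons /= h0 mulr1. Qed.

(** Induction on the number of strands in the idempotents, which [block_trace_rec]
lowers. *)
Lemma block_trace_of_chains :
    (forall mu : seq nat, 0%N \notin mu -> sumn mu = r -> Phi [::] mu = \prod_(k <- mu) g k) ->
  forall nu mu : seq nat, 0%N \notin mu -> (sumn nu + sumn mu = r)%N ->
    Phi nu mu = (\prod_(k <- nu) h k) * \prod_(k <- mu) g k.
Proof.
move=> Phi_chains nu mu; rewrite -/(value nu mu).
have [N] := ubnP (sumn nu); elim: N => // N IHN in nu mu *.
elim/last_ind: nu => [|nu [|k] IHnu] ltN mu0 def_r.
- by rewrite Phi_chains // /value big_nil mul1r.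
- by rewrite block_trace_rcons0 value_rcons0 IHnu //; move: ltN def_r; rewrite sumn_rcons; lia.
apply: (scalerI (qint_neq0 k)); rewrite sumn_rcons in ltN def_r.
rewrite block_trace_rec ?value_rec; [|lia|lia]; apply: eq_bigr => j _.
have ltjk := ltn_ord j; rewrite IHN ?sumn_rcons ?inE //=; lia.
Qed.

(** Induction on the number of strands in the cycles: in [block_trace_rec] the term
with the longest cycle has coefficient q^k, which is invertible, and all other
terms have fewer strands in cycles. *)
Lemma block_trace_of_idems :
    (forall nu, sumn nu = r -> Phi nu [::] = \prod_(k <- nu) h k) ->
  forall nu mu : seq nat, 0%N \notin mu -> (sumn nu + sumn mu = r)%N ->
    Phi nu mu = (\prod_(k <- nu) h k) * \prod_(k <- mu) g k.
Proof.
move=> Phi_idems nu mu; rewrite -/(value nu mu).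
have [N] := ubnP (sumn mu); elim: N => // N IHN in nu mu *.
case: mu => [|[|k] mu] //= ltN mu0 def_r.
  by rewrite Phi_idems ?[in RHS]/value ?big_nil ?mulr1 // -def_r addn0.
have {}mu0 : 0%N \notin mu by [].
have ler : (sumn nu + k.+1 + sumn mu <= r)%N by lia.
have ltkr : (k < r)%N by lia.
have := block_trace_rec ler; rewrite IHN // ?sumn_rcons; [|lia|lia].
rewrite value_rec // !big_ord_recr /= subnn block_trace_rcons0 value_rcons0.
rewrite (eq_bigr (fun j : 'I_k => q ^+ j *: Phi (rcons nu (k - j)%N) (j.+1 :: mu))).
  by move/addrI/(scalerI (expf_neq0 _ q0))->.
by move=> j _; have ltjk := ltn_ord j; rewrite IHN ?sumn_rcons //=; lia.
Qed.
End Evaluate.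
End Trace.
End TwoSided.
End Symmetrizers.

(** * Coset words and the expansion of the symmetrisers *)

Section BlockStart.

(** The first point of the block of p, when consecutive blocks of sizes nu start at
a.  Beyond the last block every point is a block of its own. *)
Fixpoint block_start (a : nat) (nu : seq nat) (p : nat) : nat :=
  if nu is k :: nu' then
    if (p < a + k)%N then a else block_start (a + k) nu' p
  else p.

Lemma block_start_bounds a nu p : (a <= p)%N -> (a <= block_start a nu p <= p)%N.
Proof.
elim: nu a => [|k nu IHnu] a le_ap /=; first by rewrite le_ap /=.
case: ltnP => [_|le_akp]; first by rewrite leqnn.
by have /andP[le_ak ->] := IHnu _ le_akp; rewrite andbT (leq_trans _ le_ak) ?leq_addr.
Qed.

Lemma block_start_const a nu p y : (a <= p)%N ->
  (block_start a nu p <= y <= p)%N -> block_start a nu y = block_start a nu p.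
Proof.
elim: nu a => [|k nu IHnu] a le_ap /=; first by case/andP; lia.
case: (ltnP p) => [ltp|le_akp]; first by move=> leyp; rewrite ifT //; lia.
move=> ley; have := block_start_bounds nu le_akp => /andP[le_ak _].
by rewrite ifF ?IHnu //; lia.
Qed.

Lemma reshape_index_cons k nu x : reshape_index (k :: nu) x =
  if (x < k)%N then 0%N else (reshape_index nu (x - k)).+1.
Proof.
rewrite /reshape_index /=; case: ltnP => [ltxk|lekx]; first by rewrite ifT //; lia.
by rewrite ifF ?subSn //; lia.
Qed.

Lemma block_start_eq a nu x y : (x < sumn nu)%N -> (y < sumn nu)%N ->
  (block_start a nu (a + x) == block_start a nu (a + y)) =
  (reshape_index nu x == reshape_index nu y).
Proof.
elim: nu a x y => //= k nu IHnu a x y ltx lty.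
rewrite !reshape_index_cons !ltn_add2l.
have [ltxk|lekx] := ltnP x k; have [ltyk|leky] := ltnP y k; rewrite ?eqxx //.
- have /(block_start_bounds nu)/andP[+ _] : (a + k <= a + y)%N by lia.
  by move=> lek; apply/negbTE; lia.
- have /(block_start_bounds nu)/andP[+ _] : (a + k <= a + x)%N by lia.
  by move=> lek; apply/negbTE; lia.
have -> : (a + x = (a + k) + (x - k))%N by lia.
have -> : (a + y = (a + k) + (y - k))%N by lia.
by rewrite IHnu //; lia.
Qed.
End BlockStart.

Section Words.

Fixpoint down_run (p s : nat) : seq nat :=
  if s is s'.+1 then p.-1 :: down_run p.-1 s' else [::].

Definition coset_words (a p : nat) : seq (seq nat) :=
  [seq down_run p s | s <- iota 0 (p - a).+1].

Variable st : nat -> nat.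

(** Words of the permutations of the first p points that preserve the blocks, built
by adding one point at a time; st gives the first point of each block. *)
Fixpoint words (p : nat) : seq (seq nat) :=
  if p is p'.+1 then [seq w ++ u | w <- words p', u <- coset_words (st p') p']
  else [:: [::]].

Lemma wordsS p :
  words p.+1 = [seq w ++ u | w <- words p, u <- coset_words (st p) p].
Proof. by []. Qed.

Lemma size_down_run p s : size (down_run p s) = s.
Proof. by elim: s p => //= s IHs p; rewrite IHs. Qed.

Lemma down_run_bound p s : (s <= p)%N -> all (fun i => i < p)%N (down_run p s).
Proof.
elim: s p => // s IHs [|p] //=; rewrite ltnS => le_sp; rewrite ltnSn /=.
by apply: sub_all (IHs p le_sp) => i /ltnW.
Qed.

Lemma words_bound p w : w \in words p -> all (fun i => i.+1 < p)%N w.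
Proof.
elim: p w => [|p IHp] w; first by rewrite inE => /eqP->.
move=> /allpairsPdep[w1 [u [/IHp w1_p /mapP[s]]]]; rewrite mem_iota => lts -> ->.
rewrite all_cat; apply/andP; split; first by apply: sub_all w1_p => i /ltnW.
by apply/down_run_bound; lia.
Qed.

Section Algebra.
Variables (K : fieldType) (q : K) (A : algType K) (T : nat -> A).

Lemma coset_sum_words a k :
  coset_sum q T a k =
  \sum_(w <- coset_words a (a + k)) q ^+ size w *: \prod_(i <- w) T i.
Proof.
rewrite /coset_words addKn big_map -[iota _ _]/(index_iota 0 k.+1) big_mkord.
elim: k => [|k IHk]; first by rewrite big_ord1 big_nil expr0 scale1r.
rewrite big_ord_recl big_nil expr0 scale1r /= IHk mulr_sumr scaler_sumr.
congr (_ + _); apply: eq_bigr => s _.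
by rewrite /bump /= big_cons addnS /= !size_down_run -scalerAr scalerA -exprS.
Qed.

Lemma prod_coset_sum_words p : (forall i, st i <= i)%N ->
  \prod_(0 <= i < p) coset_sum q T (st i) (i - st i) =
  \sum_(w <- words p) q ^+ size w *: \prod_(i <- w) T i.
Proof.
move=> st_le; elim: p => [|p IHp].
  by rewrite big_geq //= big_seq1 big_nil expr0 scale1r.
rewrite big_nat_recr // [LHS]/= IHp wordsS big_allpairs_dep mulr_suml; apply: eq_bigr => w _.
rewrite coset_sum_words subnKC // mulr_sumr; apply: eq_bigr => u _.
by rewrite big_cat size_cat exprD -scalerAl -scalerAr scalerA.
Qed.

Fixpoint symmetrizers (a : nat) (nu : seq nat) : A :=
  if nu is k :: nu' then symmetrizer q T a k * symmetrizers (a + k) nu' else 1.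

Lemma symmetrizers_prod a nu :
  symmetrizers a nu = \prod_(a <= i < a + sumn nu)
    coset_sum q T (block_start a nu i) (i - block_start a nu i).
Proof.
elim: nu a => [|k nu IHnu] a /=; first by rewrite addn0 big_geq.
rewrite (@big_cat_nat _ _ _ (a + k)%N) /= ?leq_add2l ?leq_addr // addnA IHnu.
congr (_ * _); last first.
  by apply: eq_big_nat => i /andP[lei _]; rewrite ltnNge lei.
rewrite (eq_big_nat _ _ (F2 := fun i => coset_sum q T a (i - a))).
  elim: k => [|k IHk]; first by rewrite addn0 big_geq.
  by rewrite addnS big_nat_recr ?leq_addr //= -IHk addKn.
by move=> i /andP[_ ->].
Qed.

Lemma symmetrizers_idems a nu : (forall k, qint q k.+1 != 0) ->
  symmetrizers a nu = (\prod_(k <- nu) qfact q k) *: sym_idems q T a nu.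
Proof.
move=> qint0; elim: nu a => [|k nu IHnu] a /=; first by rewrite big_nil scale1r.
rewrite big_cons IHnu /sym_idem -!scalerAl -scalerAr !scalerA mulrAC.
by rewrite divff ?mul1r ?qfact_neq0.
Qed.
End Algebra.
End Words.

(** * Reduced words of the elements of a Young subgroup *)

Section AdjacentWords.
Variable n : nat.

(** [stp] and [wperm] are [adj_transp] and [word_perm] on words of natural numbers,
which spares the bounds in the recursions on words. *)
Definition stp (i : nat) : 'S_n.+1 := tperm (inord i) (inord i.+1).
Definition wperm (w : seq nat) : 'S_n.+1 :=
  foldr (fun i g => (g * stp i)%g) 1%g w.

Lemma wperm_cat w u : wperm (w ++ u) = (wperm u * wperm w)%g.
Proof. by elim: w => [|i w IHw] /=; rewrite ?mulg1 // IHw mulgA. Qed.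

Lemma stpE i (x : 'I_n.+1) : (i < n)%N ->
  stp i x = (if x == i :> nat then i.+1 else if x == i.+1 :> nat then i else x)
    :> nat.
Proof.
move=> ltin; rewrite /stp.
have vi : (inord i : 'I_n.+1) = i :> nat by rewrite inordK //; lia.
have vi1 : (inord i.+1 : 'I_n.+1) = i.+1 :> nat by rewrite inordK //; lia.
have [->|/eqP xi] := eqVneq x (inord i); first by rewrite tpermL vi eqxx.
have [->|/eqP xi1] := eqVneq x (inord i.+1).
  by rewrite tpermR vi1 vi eqxx ifF //; lia.
rewrite tpermD; [|by rewrite eq_sym; apply/eqP|by rewrite eq_sym; apply/eqP].
case: eqP => [xE|_]; first by case: xi; apply: val_inj; rewrite /= vi.
by case: eqP => [xE|//]; case: xi1; apply: val_inj; rewrite /= vi1.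
Qed.

Lemma adj_transpE (i : 'I_n.+1.-1) : adj_transp i = stp i.
Proof.
have ltin : (i < n)%N := ltn_ord i.
by congr tperm; apply: val_inj; rewrite /= inordK // ltnS // ltnW.
Qed.

Definition inversions (h : 'S_n.+1) : {set 'I_n.+1 * 'I_n.+1} :=
  [set p : 'I_n.+1 * 'I_n.+1 | (p.1 < p.2)%N && (h p.2 < h p.1)%N].
(** The inverse makes left extension of a word act on positions of the one-line
notation. *)
Definition inv_number (g : 'S_n.+1) : nat := #|inversions g^-1%g|.

(** Multiplication by an adjacent transposition permutes the pairs of positions and
keeps their order, except for the one pair that it swaps. *)
Lemma inv_number_stp g i : (i < n)%N ->
  (inv_number (g * stp i)%g + (g^-1%g (inord i.+1) < g^-1%g (inord i)))%N =
  (inv_number g + (g^-1%g (inord i) < g^-1%g (inord i.+1)))%N.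
Proof.
move=> ltin; rewrite /inv_number invMg tpermV -/(stp i).
set h := (g^-1)%g; set s := stp i; set p0 := (inord i : 'I_n.+1, inord i.+1 : 'I_n.+1).
rewrite (cardsD1 p0 (inversions h)) (cardsD1 p0 (inversions _)) !inE /= !permM.
have vi : (inord i : 'I_n.+1) = i :> nat by rewrite inordK //; lia.
have vi1 : (inord i.+1 : 'I_n.+1) = i.+1 :> nat by rewrite inordK //; lia.
rewrite {1 2}/s /stp tpermL tpermR vi vi1 ltnSn /=.
pose f p := (s p.1, s p.2) : 'I_n.+1 * 'I_n.+1.
have f_inj : injective f by case=> [a b] [c d] [/perm_inj-> /perm_inj->].
suff -> : inversions (s * h)%g :\ p0 = f @^-1: (inversions h :\ p0).
  by rewrite card_preimset // [RHS]addnC addnA addnAC.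
apply/setP => [[x y]]; rewrite !inE /= !permM andbCA andbA [RHS]andbA.
rewrite (_ : (x < y)%N && _ = ((s x, s y) != p0) && (s x < s y)%N); last first.
  rewrite !xpair_eqE -!val_eqE /= !stpE // vi vi1.
  move: (x : nat) (y : nat) => a b {x y}.
  by case: (a =P i); case: (b =P i); case: (a =P i.+1); case: (b =P i.+1); lia.
by [].
Qed.

Lemma inv_number_stp_le g i : (i < n)%N -> (inv_number (g * stp i)%g <= (inv_number g).+1)%N.
Proof. by move/(inv_number_stp g); lia. Qed.

Lemma inv_number_stp_lt (g : 'S_n.+1) i : (i < n)%N ->
  (g^-1%g (inord i) < g^-1%g (inord i.+1))%N -> inv_number (g * stp i)%g = (inv_number g).+1.
Proof. by move/(inv_number_stp g)=> + lth; rewrite lth; lia. Qed.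

Lemma inv_number1 : inv_number 1%g = 0%N.
Proof.
apply/eqP; rewrite cards_eq0; apply/eqP/setP => p; rewrite !inE invg1 !perm1.
by apply/negbTE; lia.
Qed.

Lemma inv_number_word_perm (w : seq 'I_n.+1.-1) : (inv_number (word_perm w) <= size w)%N.
Proof.
elim: w => [|i w IHw] /=; first by rewrite inv_number1.
by rewrite adj_transpE (leq_trans (inv_number_stp_le _ _)) // ltnS.
Qed.

(** In one-line notation the run moves the entry at position p - s to position p. *)
Lemma wperm_down_runV p s (x : 'I_n.+1) : (s <= p)%N -> (p < n.+1)%N ->
  (wperm (down_run p s))^-1%g x =
    (if x == p :> nat then p - s else if (p - s <= x < p)%N then x.+1 else x)%N
    :> nat.
Proof.
elim: s p x => [|s IHs] [|p] x //= le_sp ltpn.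
- by rewrite invg1 perm1; case: eqP; lia.
- by rewrite invg1 perm1; case: eqP => [->|]; [lia|case: ifP; lia].
rewrite invMg tpermV permM -/(stp p) IHs ?stpE //; last exact: ltnW.
move: (x : nat) => a {x}.
by case: (a =P p); case: (a =P p.+1); do ?[case: ifP]; lia.
Qed.

Section Blocks.
Variable st : nat -> nat.
Hypotheses (st_le : forall p, (st p <= p)%N)
  (st_const : forall p y, (st p <= y <= p)%N -> st y = st p).
Local Notation words := (words st).

Lemma inv_number_down_run (g : 'S_n.+1) a p s :
    (p < n.+1)%N -> (s <= p - a)%N ->
    (forall x y : 'I_n.+1, (a <= x)%N -> (x < y <= p)%N ->
       (g^-1%g x < g^-1%g y)%N) ->
  inv_number (g * wperm (down_run p s))%g = (s + inv_number g)%N.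
Proof.
elim: s p => [|s IHs] [|p] ltpn les g_inc //=; rewrite ?mulg1 //.
have les' : (s <= p - a)%N by lia.
have g_inc' (x y : 'I_n.+1) : (a <= x)%N -> (x < y <= p)%N ->
  (g^-1%g x < g^-1%g y)%N by move=> leax ltxy; apply: g_inc => //; lia.
rewrite mulgA inv_number_stp_lt ?(IHs p (ltnW ltpn)) //.
have v1 : (wperm (down_run p s))^-1%g (inord p) = (p - s)%N :> nat.
  by rewrite wperm_down_runV ?inordK ?eqxx //; lia.
have v2 : (wperm (down_run p s))^-1%g (inord p.+1) = p.+1 :> nat.
  by rewrite wperm_down_runV ?inordK ?ifF //; lia.
by rewrite !invMg !permM; apply: g_inc; rewrite ?v1 ?v2; lia.
Qed.

(** Each letter exchanges two adjacent entries that are in increasing order: a run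
moves the entry of a position to the right across larger ones, and the remaining
positions of its block stay increasing.  Hence these words are reduced. *)
Lemma inv_number_words p w (g : 'S_n.+1) : (p <= n.+1)%N -> w \in words p ->
    (forall x y : 'I_n.+1, (x < y < p)%N -> st x = st y ->
       (g^-1%g x < g^-1%g y)%N) ->
  inv_number (g * wperm w)%g = (size w + inv_number g)%N.
Proof.
elim: p w g => [|p IHp] w g ltpn.
  by rewrite inE => /eqP-> _; rewrite mulg1.
rewrite wordsS => /allpairsPdep[w1 [u [w1_p /mapP[s]]]].
rewrite mem_iota add0n ltnS => /= les -> -> g_inc.
have stx x : (st p <= x <= p)%N -> st x = st p by apply: st_const.
have le_sp : (s <= p)%N by lia.
have len_u : inv_number (g * wperm (down_run p s))%g = (s + inv_number g)%N.
  apply: (@inv_number_down_run _ (st p)) => // x y lex lexy.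
  by apply: g_inc; rewrite ?stx //; lia.
rewrite wperm_cat mulgA IHp ?(ltnW ltpn) // ?len_u ?size_cat ?size_down_run ?addnA //.
move=> x y ltxy eqst; rewrite invMg !permM; have stp_p := st_le p.
have vE (z : 'I_n.+1) : (z < p)%N -> (wperm (down_run p s))^-1%g z =
    (if (p - s <= z)%N then z.+1 else z) :> nat.
  by move=> ltzp; rewrite wperm_down_runV // ltzp andbT ifF //; lia.
have [ltx lty] : (x < p)%N /\ (y < p)%N by lia.
have [stx1 sty1] : ((p - s <= x)%N -> st x.+1 = st p /\ st x = st p) /\
  ((p - s <= y)%N -> st y.+1 = st p /\ st y = st p).
  by split=> lez; rewrite !stx //; lia.
apply: g_inc; rewrite !vE //; do 2?case: ifP; lia.
Qed.

Definition block_perms (p : nat) : {set 'S_n.+1} :=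
  [set g : 'S_n.+1 | [forall x : 'I_n.+1,
     ((p <= x)%N ==> (g x == x)) && (st (g x) == st x)]].

Lemma block_permsP p (g : 'S_n.+1) :
  reflect (forall x : 'I_n.+1, ((p <= x)%N -> g x = x) /\ st (g x) = st x)
          (g \in block_perms p).
Proof.
rewrite inE; apply: (iffP forallP) => gP x.
  by have /andP[/implyP gx /eqP stg] := gP x; split=> // /gx/eqP.
by have [gx ->] := gP x; rewrite eqxx andbT; apply/implyP => /gx->.
Qed.

(** The words enumerate the block-preserving permutations without repetition: a
permutation g of p + 1 points is determined by the point that it sends to p, which
fixes the last run, and by a permutation that fixes p. *)
Lemma words_sum (V : nmodType) (phi : 'S_n.+1 -> V) p : (p <= n.+1)%N ->
  \sum_(w <- words p) phi (wperm w) = \sum_(g in block_perms p) phi g.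
Proof.
elim: p phi => [|p IHp] phi ltpn.
  rewrite big_seq1 (big_pred1 (1%g : 'S_n.+1)) // => g /=.
  apply/block_permsP/eqP => [gP|-> x]; last by rewrite perm1.
  by apply/permP => x; rewrite perm1; have [->] := gP x.
set k := (p - st p)%N.
have stp_p := st_le p.
have stx x : (st p <= x <= p)%N -> st x = st p by apply: st_const.
rewrite wordsS big_allpairs_dep exchange_big big_map.
rewrite -[iota _ _]/(index_iota 0 k.+1) big_mkord.
pose pp : 'I_n.+1 := Ordinal ltpn.
have valV (g : 'S_n.+1) : g \in block_perms p.+1 -> (st p <= g^-1%g pp <= p)%N.
  move=> /block_permsP gP; have [_ stg] := gP (g^-1%g pp).
  rewrite permKV /= in stg; rewrite stg st_le leqNgt /=; apply/negP => ltp.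
  have [/(_ ltp) gx _] := gP (g^-1%g pp).
  by move: ltp; rewrite -[in X in (_ < X)%N]gx permKV ltnn.
rewrite [RHS](partition_big (fun g : 'S_n.+1 => inord (p - g^-1%g pp) : 'I_k.+1) predT) //=.
apply: eq_bigr => s _; have lesk : (s <= k)%N by have := ltn_ord s; lia.
have le_sp : (s <= p)%N by rewrite (leq_trans lesk) ?leq_subr.
set c := wperm (down_run p s).
have cV x : c^-1%g x = _ :> nat := wperm_down_runV x le_sp ltpn.
have c_in : c^-1%g \in block_perms p.+1.
  apply/block_permsP => x; split=> [ltpx|].
    by apply: val_inj; rewrite /= cV !ifF; lia.
  by rewrite cV; do ?[case: ifP]; try lia; move=> *; rewrite !stx; lia.
have cVpp : c^-1%g pp = (p - s)%N :> nat by rewrite cV eqxx.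
have c_mem g : (c * g)%g \in block_perms p.+1 -> g \in block_perms p.+1.
  move=> /block_permsP gP; apply/block_permsP => x.
  have [gx stg] := gP (c^-1%g x); rewrite permM permKV in gx stg.
  have [cx stc] := block_permsP _ _ c_in x.
  split=> [ltpx|]; last by rewrite stg stc.
  by rewrite gx ?cx.
under eq_bigr do rewrite wperm_cat.
rewrite (IHp (fun g => phi (c * g)%g)); last exact: ltnW.
rewrite [RHS](reindex_inj (mulgI c)); apply: eq_bigl => g.
apply/block_permsP/andP => [gP|[cg_in /eqP cgs]].
  have cg_in : (c * g)%g \in block_perms p.+1.
    apply/block_permsP => x; rewrite permM; have [gx stg] := gP (c x).
    have [] := block_permsP _ _ c_in (c x); rewrite permK => cx stc.
    split=> [ltpx|]; last by rewrite stg stc.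
    have [/(_ ltpx) cVx _] := block_permsP _ _ c_in x.
    have cxx : c x = x by rewrite -{1}cVx permKV.
    by rewrite cxx in gx *; apply: gx; apply: ltnW.
  split=> //; apply/eqP/val_inj; rewrite /= invMg permM.
  have [gpp _] := gP pp.
  have -> : g^-1%g pp = pp by apply: (canLR (permK _)); rewrite gpp.
  by rewrite cVpp inordK ?subKn //; lia.
have g_in := c_mem _ cg_in; have /block_permsP gP := g_in.
have gVpp : g^-1%g pp = pp.
  apply: (perm_inj (s := c^-1%g)); rewrite -permM -invMg; apply: val_inj.
  rewrite /= cVpp; move: cgs => /(congr1 val) /=.
  have defk : k = (p - st p)%N by [].
  by have := valV _ cg_in; move: (nat_of_ord _) => v lev; rewrite inordK; lia.
move=> x; have [gx stg] := gP x; split=> //.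
rewrite leq_eqVlt => /predU1P[px|]; last exact: gx.
have -> : x = pp by apply: val_inj.
by apply: (canLR (permKV _)).
Qed.
End Blocks.
End AdjacentWords.

(** * Specialisation at q = 1 and the characters at the idempotents *)

Section Idempotent.
Lemma mxtrace_idem (K : fieldType) d (P : 'M[K]_d) :
  P *m P = P -> \tr P = (\rank P)%:R.
Proof.
move=> PP; have baseK : row_base P *m col_base P = 1%:M.
  have /row_freeP[R' RR'] := row_base_free P.
  have /row_fullP[L' LL'] := col_base_full P.
  have idem : col_base P *m row_base P *m (col_base P *m row_base P) =
      col_base P *m row_base P by rewrite mulmx_base.
  move: (col_base P) (row_base P) => C R in RR' LL' idem *.
  have := congr1 (fun X => L' *m X *m R') idem; rewrite /=.
  by rewrite -!mulmxA RR' mulmx1 !mulmxA LL' !mul1mx.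
by rewrite -{1}(mulmx_base P) mxtrace_mulC baseK mxtrace1.
Qed.
End Idempotent.

Section Laurent.
Variables (K : fieldType) (q : K).
Hypothesis q_trans : forall p : {poly int}, (map_poly intr p).[q] = 0 -> p = 0.

(** The graph of the ring morphism from Z[q, q^-1] to the integers that sends q to
1, when q is transcendental. *)
Definition specializes (a : K) (c : algC) : Prop :=
  exists (p : {poly int}) (k : nat),
    a = (map_poly intr p).[q] / q ^+ k /\ (p.[1])%:~R = c.

Lemma trans_neq0 : q != 0.
Proof.
apply/eqP => q0; have := @q_trans 'X.
by rewrite map_polyX hornerX => /(_ q0)/eqP; rewrite polyX_eq0.
Qed.
Let q0 := trans_neq0.

Lemma specializes_unique a c c' : specializes a c -> specializes a c' -> c = c'.
Proof.
case=> p [k [-> <-]] [p' [k' [def_a <-]]].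
suff /(congr1 (horner^~ 1)) : p * 'X^k' = p' * 'X^k.
  by rewrite /= !hornerE !expr1n !mulr1 => ->.
apply/eqP; rewrite -subr_eq0; apply/eqP/q_trans.
rewrite rmorphB !rmorphM /= !map_polyXn !hornerE; apply/eqP; rewrite subr_eq0.
by rewrite -eqr_div ?expf_neq0 // def_a.
Qed.

Lemma specializes_poly p : specializes (map_poly intr p).[q] (p.[1])%:~R.
Proof. by exists p, 0%N; rewrite expr0 divr1. Qed.

Lemma specializes_nat k : specializes k%:R k%:R.
Proof.
by have := specializes_poly k%:R; rewrite rmorph_nat !hornerMn !hornerC rmorphMn.
Qed.

Lemma specializes_q : specializes q 1.
Proof. by have := specializes_poly 'X; rewrite map_polyX !hornerX. Qed.

Lemma specializes_mul a b c d :
  specializes a c -> specializes b d -> specializes (a * b) (c * d).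
Proof.
case=> p [k [-> <-]] [p' [k' [-> <-]]]; exists (p * p'), (k + k')%N.
by rewrite rmorphM !hornerM exprD invfM mulrACA intrM.
Qed.

Lemma specializes_add a b c d :
  specializes a c -> specializes b d -> specializes (a + b) (c + d).
Proof.
case=> p [k [-> <-]] [p' [k' [-> <-]]].
exists (p * 'X^k' + p' * 'X^k), (k + k')%N; split.
  rewrite rmorphD !rmorphM /= !map_polyXn !hornerE exprD.
  by rewrite addf_div ?expf_neq0.
by rewrite !hornerE !expr1n !mulr1 intrD.
Qed.

Lemma specializes_exp k : specializes (q ^+ k) 1.
Proof.
elim: k => [|k IHk]; first exact: (specializes_nat 1).
by rewrite exprS -[1]mulr1; apply: specializes_mul (specializes_q) IHk.
Qed.

Lemma specializes_sum (I : eqType) (s : seq I) (a : I -> K) (c : I -> algC) :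
  (forall i, i \in s -> specializes (a i) (c i)) ->
  specializes (\sum_(i <- s) a i) (\sum_(i <- s) c i).
Proof.
move=> sp_a; rewrite big_seq [X in specializes _ X]big_seq.
by elim/big_ind2: _ => //; [apply: (specializes_nat 0)|move=> *; apply: specializes_add].
Qed.

Lemma trans_qint_neq0 k : qint q k.+1 != 0.
Proof.
apply/eqP => qk0; have [p pE p1] : exists2 p : {poly int},
    (map_poly intr p).[q] = qint q k.+1 & p.[1] = k.+1.
  exists (\sum_(i < k.+1) 'X^(2 * i)).
    rewrite rmorph_sum horner_sum; apply: eq_bigr => i _.
    by rewrite /= map_polyXn hornerXn.
  rewrite horner_sum (eq_bigr (fun=> 1)) => [|i _]; last by rewrite hornerXn expr1n.
  by rewrite sumr_const card_ord -mulr_natr mul1r natz.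
by move: p1; rewrite (@q_trans p) ?pE // horner0.
Qed.
End Laurent.

Section NaturalGenerators.
Variables (n : nat) (K : fieldType) (q : K) (A : algType K).

(** The value 1 out of range keeps products over words total. *)
Definition nat_gen (T : 'I_n.+1.-1 -> A) (i : nat) : A := oapp T 1 (insub i).

Lemma hecke_relations_nat T : hecke_relations q T -> hecke_rels q (nat_gen T) n.+1.
Proof.
case=> quad braid far.
have genE i : (i < n)%N -> exists2 o : 'I_n.+1.-1, o = i :> nat & nat_gen T i = T o.
  by move=> lti; exists (Ordinal lti); rewrite // /nat_gen insubT.
split=> [i /genE[o _ ->]|i lti|i j ltij /genE[oj ej ->]].
- by rewrite -expr2.
- have [o ei ->] := genE i (ltnW lti); have [o1 ei1 ->] := genE i.+1 lti.
  by apply: braid; rewrite ei ei1.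
have [oi ei ->] : exists2 o : 'I_n.+1.-1, o = i :> nat & nat_gen T i = T o.
  by apply: genE; have := ltn_ord oj; rewrite ej /=; lia.
by apply: far; rewrite ei ej ltij.
Qed.

End NaturalGenerators.

Section Young.
Variables (n : nat) (nu : seq nat).
Hypothesis nu_n : sumn nu = n.+1.
Local Notation st := (block_start 0 nu).
Local Notation words := (words st n.+1).

Let st_le p : (st p <= p)%N.
Proof. by have /andP[] := block_start_bounds nu (leq0n p). Qed.

Let st_const p y : (st p <= y <= p)%N -> st y = st p.
Proof. exact: block_start_const. Qed.

Lemma block_perms_young : block_perms n st n.+1 = young_set n.+1 nu.
Proof.
apply/setP => g; rewrite !inE; apply/eq_forallb => x.
by rewrite leqNgt ltn_ord /= -(block_start_eq 0) ?nu_n.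
Qed.

Definition ord_word (w : seq nat) : seq 'I_n.+1.-1 := pmap insub w.

Lemma ord_word_perm w : all (fun i => i < n)%N w -> word_perm (ord_word w) = wperm n w.
Proof.
elim: w => //= i w IHw /andP[lti ltw]; rewrite /ord_word /= insubT /=.
by rewrite IHw // adj_transpE.
Qed.

Lemma words_ltn w : w \in words -> all (fun i => i < n)%N w.
Proof. by move/words_bound; apply: sub_all => i; rewrite ltnS. Qed.

Lemma words_reduced w : w \in words -> reduced_word (ord_word w) (wperm n w).
Proof.
move=> w_in; have w_n := words_ltn w_in; split; first exact: ord_word_perm.
move=> w' def_w'; have := inv_number_word_perm w'; rewrite def_w'; apply: leq_trans.
have -> : size (ord_word w) = size w.
  elim: w w_n {w_in w' def_w'} => //= i w IHw /andP[lti /IHw].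
  by rewrite /ord_word /= insubT /= => ->.
rewrite -[wperm n w]mul1g (inv_number_words st_le st_const _ w_in) ?inv_number1 ?addn0 //.
by move=> x y; rewrite invg1 !perm1; lia.
Qed.

Section Algebra.
Variables (K : fieldType) (q : K) (A : algType K).

Lemma prod_nat_gen (T : 'I_n.+1.-1 -> A) w : all (fun i => i < n)%N w ->
  \prod_(i <- w) nat_gen T i = \prod_(i <- ord_word w) T i.
Proof.
elim: w => [|i w IHw] /=; first by rewrite !big_nil.
case/andP=> lti ltw; rewrite big_cons IHw // /ord_word /= /nat_gen insubT /=.
by rewrite big_cons.
Qed.

Lemma symmetrizers_words (T : nat -> A) :
  symmetrizers q T 0 nu = \sum_(w <- words) q ^+ size w *: \prod_(i <- w) T i.
Proof.
by rewrite symmetrizers_prod add0n nu_n prod_coset_sum_words.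
Qed.
End Algebra.

(** The one-dimensional representation T_i = q of the Hecke algebra sends the
symmetriser to this product. *)
Lemma prod_qfact_words (K : fieldType) (q : K) :
  \prod_(k <- nu) qfact q k = \sum_(w <- words) q ^+ (size w) * q ^+ (size w).
Proof.
have -> : \prod_(k <- nu) qfact q k = symmetrizers q (fun=> q : K^o) 0 nu.
  elim: (nu) 0%N => [|k nu' IHnu] a /=; first by rewrite big_nil.
  rewrite big_cons (IHnu (a + k)%N); congr (_ * _).
  rewrite -[RHS](mulr1 (symmetrizer q (fun=> q : K^o) a k)).
  by rewrite symmetrizer_mul // [RHS]mulr1.
rewrite symmetrizers_words; apply: eq_bigr => w _.
by rewrite big_const_seq count_predT iter_mulr_1.
Qed.

Section CharacterValue.
Variables (K : fieldType) (q : K).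
Hypothesis q_trans : forall p : {poly int}, (map_poly intr p).[q] = 0 -> p = 0.
Variables (H : algType K) (T : 'I_n.+1.-1 -> H) (relT : hecke_relations q T).
Variables (la : intpart n.+1) (chi : H -> K).
Hypothesis chi_la : is_hecke_irr_char q T la chi.

Lemma sym_idems_sqr :
  let e := sym_idems q (nat_gen T) 0 nu in e * e = e.
Proof.
have q0 := trans_neq0 q_trans; have qint0 := trans_qint_neq0 q_trans.
have relN := hecke_relations_nat relT.
move: (leqnn n.+1); rewrite -{1}nu_n -(add0n (sumn nu)) /=.
elim: (nu) 0%N => [|k nu' IHnu] a /= ltn; first by rewrite mulr1.
have comm_e : sym_idems q (nat_gen T) (a + k) nu' * sym_idem q (nat_gen T) a k
   = sym_idem q (nat_gen T) a k * sym_idems q (nat_gen T) (a + k) nu'.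
  apply: sym_idem_comm => j leaj ltj; apply/esym/sym_idems_comm => i lei lti.
  by apply: (T_commute relN); lia.
rewrite mulrA -(mulrA (sym_idem _ _ _ _)) comm_e mulrA.
rewrite (sym_idem_sqr q0 relN qint0); last by lia.
by rewrite -mulrA IHnu // -addnA.
Qed.

(** The rank of the idempotent matrix rho(e_nu) is a natural number N, and
N * [nu]! = sum_w q^l(w) chi(T_w) specialises to N * |S_nu| = sum_(w in S_nu)
chi^la(w). *)
Lemma hecke_char_sym_idems : exists2 N : nat,
  chi (sym_idems q (nat_gen T) 0 nu) = N%:R &
  N%:R = '['chi_(sym_Iirr la), 'Ind[[set: 'S_n.+1], young_group n.+1 nu] 1].
Proof.
have q0 := trans_neq0 q_trans; have qint0 := trans_qint_neq0 q_trans.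
case: chi_la => [[d [rho [_ chiE]]] chi_spec].
set e := sym_idems q (nat_gen T) 0 nu.
have chi_e : chi e = (\rank (rho e))%:R.
  rewrite chiE mxtrace_idem // -[RHS](congr1 rho sym_idems_sqr).
  by rewrite rmorphM.
exists (\rank (rho e)) => //; set N := \rank _ in chi_e *.
have chiZ a x : chi (a *: x) = a * chi x.
  by rewrite !chiE linearZ /= mxtraceZ.
have chi_sum (s : seq (seq nat)) f : chi (\sum_(w <- s) f w) = \sum_(w <- s) chi (f w).
  by rewrite chiE rmorph_sum raddf_sum; apply: eq_bigr => w _; rewrite chiE.
have := congr1 chi (symmetrizers_words q (nat_gen T)).
rewrite symmetrizers_idems // chiZ chi_e prod_qfact_words chi_sum => key.
set X := 'chi_(sym_Iirr la) in chi_spec *.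
(* Both sides of key specialise at q = 1, the left one to N times the number of
words. *)
have lhs : specializes q (\sum_(w <- words) q ^+ size w * q ^+ size w * N%:R)
    (\sum_(w <- words) 1 * 1 * N%:R).
  apply: (specializes_sum q_trans) => w _; apply: specializes_mul; last exact: specializes_nat.
  by apply: specializes_mul; apply: specializes_exp.
have rhs : specializes q (\sum_(w <- words) chi (q ^+ size w *: \prod_(i <- w) nat_gen T i))
    (\sum_(w <- words) X (wperm n w)).
  apply: (specializes_sum q_trans) => w w_in; rewrite chiZ -[X _]mul1r.
  apply: specializes_mul; first exact: specializes_exp.
  rewrite prod_nat_gen ?words_ltn //.
  exact: chi_spec (words_reduced w_in).
rewrite -mulr_suml key in lhs.
have {lhs rhs} := specializes_unique q_trans lhs rhs.
rewrite [LHS](words_sum st_le st_const (fun=> 1 * 1 * N%:R) (leqnn n.+1)).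
rewrite [RHS](words_sum st_le st_const (fun g => X g) (leqnn n.+1)).
rewrite block_perms_young.
rewrite sumr_const !mul1r -[_ *+ #|_|]mulr_natl => valN.
rewrite -cfdot_Res_l cfdotE.
have G0 : #|young_group n.+1 nu|%:R != 0 :> algC by rewrite pnatr_eq0 -lt0n cardG_gt0.
apply: (mulfI G0); rewrite valN mulrA divff // mul1r; apply: eq_bigr => g g_in.
by rewrite cfResE ?subsetT // cfun1E g_in conjC1 mulr1.
Qed.
End CharacterValue.
End Young.

(** * Elementary, complete and power sums; the Jacobi-Trudi identity *)

Section TruncatedSeries.
Variable R : comNzRingType.
Implicit Types (p q a : {poly R}) (N : nat) (s : nat -> R).

(** Congruence modulo X^N, which replaces equality of power series. *)
Definition eqX N p q := forall i, (i < N)%N -> p`_i = q`_i.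

Lemma eqX_mul N p p' q q' :
  eqX N p p' -> eqX N q q' -> eqX N (p * q) (p' * q').
Proof.
move=> eqp eqq i ltiN; rewrite !coefM; apply: eq_bigr => j _.
by have ltji := ltn_ord j; rewrite eqp ?eqq //; lia.
Qed.

Lemma eqX_cancel N a p q : a`_0 = 1 -> eqX N (a * p) (a * q) -> eqX N p q.
Proof.
move=> a0 eqap i; have [m] := ubnP i; elim: m i => // m IHm i ltim ltiN.
have := eqap i ltiN; rewrite !coefM !big_ord_recl a0 !mul1r subn0.
rewrite (eq_bigr (fun j : 'I_i => a`_(lift ord0 j) * q`_(i - lift ord0 j))).
  by move/addIr.
by move=> j _; rewrite IHm //; have := ltn_ord j; rewrite /= /bump; lia.
Qed.

Lemma eqX_deriv N p q : eqX N.+1 p q -> eqX N p^`() q^`().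
Proof. by move=> eqpq i ltiN; rewrite !coef_deriv eqpq. Qed.

Lemma eqX_geom N (c : R) :
  eqX N ((1 - c%:P * 'X) * \poly_(i < N) c ^+ i) 1.
Proof.
move=> i ltiN; rewrite mulrBl mul1r -mulrA coefB coefCM coefXM !coef_poly coef1.
rewrite ltiN; case: i ltiN => [|i] ltiN /=; first by rewrite mulr0 subr0.
by rewrite ltnW // -exprS subrr.
Qed.

Fixpoint inv_list s (k : nat) : seq R :=
  if k is k'.+1 then
    let t := inv_list s k' in
    rcons t (if k' is k''.+1 then - \sum_(i < k') s i.+1 * t`_(k'' - i) else 1)
  else [::].

(** The coefficients of the inverse of a power series with constant term 1. *)
Definition inv_seq s k : R := (inv_list s k.+1)`_k.

Lemma size_inv_list s k : size (inv_list s k) = k.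
Proof. by elim: k => //= k IHk; rewrite size_rcons IHk. Qed.

Lemma nth_inv_list s k i : (i < k)%N -> (inv_list s k)`_i = inv_seq s i.
Proof.
elim: k => // k IHk; rewrite ltnS leq_eqVlt => /predU1P[-> // | lt_ik].
by rewrite /= nth_rcons size_inv_list lt_ik IHk.
Qed.

Lemma inv_seq0 s : inv_seq s 0 = 1. Proof. by []. Qed.

Lemma inv_seqS s k :
  inv_seq s k.+1 = - \sum_(i < k.+1) s i.+1 * inv_seq s (k - i).
Proof.
have -> : inv_seq s k.+1 = - \sum_(i < k.+1) s i.+1 * (inv_list s k.+1)`_(k - i).
  rewrite /inv_seq -[inv_list s k.+2]/(rcons (inv_list s k.+1) _).
  by rewrite nth_rcons size_inv_list ltnn eqxx.
congr (- _); apply: eq_bigr => i _.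
by rewrite nth_inv_list // ltnS leq_subr.
Qed.

Lemma eq_inv_seq s s' k : (forall i, (i <= k)%N -> s i = s' i) ->
  inv_seq s k = inv_seq s' k.
Proof.
have [m] := ubnP k; elim: m k => // m IHm [|k] ltkm eqs; first by rewrite !inv_seq0.
rewrite !inv_seqS; congr (- _); apply: eq_bigr => i _.
have ltik := ltn_ord i; rewrite eqs // (IHm (k - i)%N) //; first by lia.
by move=> j lej; rewrite eqs //; lia.
Qed.

Lemma inv_seq_unique N a p : a`_0 = 1 -> eqX N (a * p) 1 ->
  forall k, (k < N)%N -> p`_k = inv_seq (fun i => a`_i) k.
Proof.
move=> a0 ap1 k; have [m] := ubnP k; elim: m k => // m IHm k ltkm ltkN.
have := ap1 k ltkN; rewrite coefM big_ord_recl a0 mul1r subn0 coef1.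
case: k ltkm ltkN => [|k] ltkm ltkN; first by rewrite big_ord0 addr0.
rewrite inv_seqS => /(canRL (addrK _)) ->; rewrite sub0r; congr (- _).
apply: eq_bigr => i _; have ltik := ltn_ord i.
by rewrite /= /bump /= add1n subSS IHm //; lia.
Qed.

Lemma inv_seq_trunc N a : a`_0 = 1 ->
  eqX N (a * \poly_(i < N) inv_seq (fun i => a`_i) i) 1.
Proof.
move=> a0 k ltkN; rewrite coefM big_ord_recl a0 mul1r subn0 coef_poly ltkN coef1.
case: k ltkN => [|k] ltkN; first by rewrite big_ord0 addr0.
rewrite inv_seqS addrC; apply/eqP; rewrite subr_eq0; apply/eqP.
apply: eq_bigr => i _; have ltik := ltn_ord i.
by rewrite /= /bump /= add1n subSS coef_poly ifT //; lia.
Qed.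

Lemma coef_comp_scaleX c p i : (p \Po (c%:P * 'X))`_i = c ^+ i * p`_i.
Proof.
rewrite comp_polyE coef_sum.
have termE j : (p`_j *: (c%:P * 'X) ^+ j)`_i = c ^+ i * p`_j * (i == j)%:R.
  rewrite exprMn -polyC_exp coefZ coefCM coefXn mulrCA mulrA.
  by case: eqP => [->|_]; rewrite ?mulr0.
under eq_bigr => j _ do rewrite termE.
have [lti|lei] := ltnP i (size p).
  rewrite (bigD1 (Ordinal lti)) //= eqxx mulr1 big1 ?addr0 // => j.
  by rewrite -val_eqE /= eq_sym => /negbTE->; rewrite mulr0.
rewrite [p`_i]nth_default // mulr0 big1 // => j _; have ltj := ltn_ord j.
by rewrite gtn_eqF ?mulr0 // (leq_trans ltj).
Qed.

Lemma eqX_scale N c p q :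
  eqX N p q -> eqX N (p \Po (c%:P * 'X)) (q \Po (c%:P * 'X)).
Proof. by move=> eqpq i ltiN; rewrite !coef_comp_scaleX eqpq. Qed.
End TruncatedSeries.

Lemma rmorph_inv_seq (R R' : comNzRingType) (f : {rmorphism R -> R'}) s k :
  f (inv_seq s k) = inv_seq (f \o s) k.
Proof.
have [m] := ubnP k; elim: m k => // m IHm [|k] ltkm; first by rewrite !inv_seq0 rmorph1.
rewrite !inv_seqS rmorphN rmorph_sum; congr (- _); apply: eq_bigr => i _.
by rewrite rmorphM /= IHm //; lia.
Qed.

Section Alphabet.
Variables (R : comNzRingType) (n : nat) (z : 'I_n.+1 -> R).

Definition alt_elem : {poly R} := \prod_i (1 - (z i)%:P * 'X).
Definition elem k : R := (-1) ^+ k * alt_elem`_k.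
Definition compl k : R := inv_seq (fun i => alt_elem`_i) k.
Definition psum k : R := \sum_i z i ^+ k.
Local Notation eps := alt_elem.
Local Notation hp N := (\poly_(i < N) compl i).
Let eps_ j := \prod_(i | i != j) (1 - (z i)%:P * 'X).

Lemma alt_elem0 : eps`_0 = 1.
Proof.
rewrite -horner_coef0 horner_prod big1 // => i _.
by rewrite !hornerE ?mulr0 ?subr0.
Qed.

Lemma alt_elemE j : eps = (1 - (z j)%:P * 'X) * eps_ j.
Proof. by rewrite /eps (bigD1 j). Qed.

Lemma compl_trunc N : eqX N (eps * hp N) 1.
Proof. exact/inv_seq_trunc/alt_elem0. Qed.

Lemma deriv_alt_elem : eps^`() = - \sum_i (z i)%:P * eps_ i.
Proof.
have d1 i : (1 - (z i)%:P * 'X : {poly R})^`() = - (z i)%:P.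
  by rewrite -polyC1 derivB derivM derivX !derivC mul0r add0r mulr1 add0r.
rewrite /eps /eps_ -sumrN.
have deriv_prod (r : seq 'I_n.+1) : uniq r ->
   (\prod_(i <- r) (1 - (z i)%:P * 'X))^`() =
   \sum_(i <- r) - ((z i)%:P * \prod_(j <- r | j != i) (1 - (z j)%:P * 'X)).
  elim: r => [|a r IHr] /=; first by rewrite !big_nil derivC.
  case/andP=> a_r uniq_r; rewrite !big_cons derivM IHr // d1 eqxx /= mulNr.
  congr (- (_ * _) + _).
    rewrite big_seq [RHS]big_seq_cond; apply: eq_bigl => i.
    by case: eqP => [->|]; rewrite ?andbT ?(negbTE a_r).
  rewrite mulr_sumr big_seq [RHS]big_seq; apply: eq_bigr => i i_r.
  rewrite big_cons ifT; last by apply: contraNneq a_r => ->.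
  by rewrite mulrN mulrCA.
by rewrite deriv_prod ?index_enum_uniq.
Qed.

(** The logarithmic derivative of prod_i (1 - z_i X). *)
Lemma alt_elem_psum N : eqX N (eps * \poly_(i < N) psum i.+1) (- eps^`()).
Proof.
have -> : \poly_(i < N) psum i.+1 = \sum_j (z j)%:P * \poly_(i < N) z j ^+ i.
  apply/polyP => i; rewrite coef_poly coef_sum /psum.
  under [RHS]eq_bigr => j _ do rewrite coefCM coef_poly.
  case: ifP => _; first by apply: eq_bigr => j _; rewrite exprS.
  by rewrite big1 // => j _; rewrite mulr0.
rewrite deriv_alt_elem opprK mulr_sumr => i ltiN; rewrite !coef_sum.
apply: eq_bigr => j _; have -> : eps * ((z j)%:P * \poly_(i < N) z j ^+ i) =
    ((z j)%:P * eps_ j) * ((1 - (z j)%:P * 'X) * \poly_(i < N) z j ^+ i).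
  by rewrite (alt_elemE j); ring.
by rewrite (eqX_mul (fun _ _ => erefl) (@eqX_geom _ N (z j)) ltiN) mulr1.
Qed.

Lemma newton_elem k :
  k.+1%:R * elem k.+1 = \sum_(j < k.+1) elem (k - j) * ((-1) ^+ j * psum j.+1).
Proof.
have := alt_elem_psum (ltnSn k).
rewrite coefN coef_deriv mulrC coefM => E.
transitivity ((-1) ^+ k * - (eps`_k.+1 *+ k.+1)).
  by rewrite /elem exprS -mulr_natl; ring.
rewrite -E mulr_sumr.
apply: eq_bigr => j _; have ltjk := ltn_ord j; rewrite coef_poly ltjk /elem.
have {1}-> : k = (j + (k - j))%N by lia.
by rewrite exprD; ring.
Qed.

(** The series of the h_k is the inverse of that of the (-1)^k e_k, and so has the
opposite logarithmic derivative. *)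
Lemma newton_compl k :
  k.+1%:R * compl k.+1 = \sum_(j < k.+1) compl (k - j) * psum j.+1.
Proof.
have key : eqX k.+1 (hp k.+2)^`() (\poly_(i < k.+1) psum i.+1 * hp k.+2).
  apply: (eqX_cancel alt_elem0) => i ltik.
  have e1 := eqX_deriv (@compl_trunc k.+2) ltik.
  rewrite derivM -polyC1 derivC coef0 in e1.
  rewrite mulrA (eqX_mul (@alt_elem_psum k.+1) (fun _ _ => erefl)) //.
  by apply/eqP; rewrite mulNr coefN -addr_eq0 addrC -coefD e1.
have := key k (ltnSn k); rewrite coef_deriv coef_poly ltnSn mulr_natl => ->.
rewrite coefM; apply: eq_bigr => j _; have ltjk := ltn_ord j.
by rewrite !coef_poly ltjk ifT 1?mulrC //; lia.
Qed.

Definition compl_int (a : int) : R := if a is Posz k then compl k else 0.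

(** The inverse of 1 - z_j X is the series of the h_k times the product of the other
factors 1 - z_i X, which has degree at most n. *)
Lemma power_compl j p :
  z j ^+ p = \sum_(l < n.+1) compl_int (p%:Z - n%:Z + l%:Z) * (eps_ j)`_(n - l).
Proof.
have sz_eps : (size (eps_ j) <= n.+1)%N.
  pose d (r : seq 'I_n.+1) := (size (\prod_(i <- r) (1 - (z i)%:P * 'X))%R <= (size r).+1)%N.
  have size_le r : d r.
    elim: r => [|a r IHr]; rewrite /d; first by rewrite big_nil size_poly1.
    rewrite big_cons (leq_trans (size_polyMleq _ _)) //.
    have : (size (1 - (z a)%:P * 'X : {poly R})%R <= 2)%N.
      rewrite (leq_trans (size_polyD _ _)) // geq_max size_polyN size_poly1 /=.
      by rewrite (leq_trans (size_polyMleq _ _)) // size_polyX addn2 /= ltnS size_polyC leq_b1.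
    move: IHr; rewrite /d; move: (size (polyseq _)) (size (polyseq _)) => a1 a2 /=.
    by lia.
  rewrite /eps_ -big_filter (leq_trans (size_le _)) // size_filter.
  by rewrite -sum1_count sum1_card cardC1 card_ord.
have : eqX p.+1 (eps_ j * hp p.+1) (\poly_(i < p.+1) z j ^+ i).
  apply: (@eqX_cancel _ _ (1 - (z j)%:P * 'X)).
    by rewrite -horner_coef0 !hornerE ?mulr0 ?subr0.
  by move=> i ltip; rewrite mulrA -alt_elemE compl_trunc // eqX_geom.
move/(_ p (ltnSn p)); rewrite coef_poly ltnSn => <-.
transitivity (\sum_(l < n.+1) (eps_ j)`_l * compl_int (p%:Z - l%:Z)).
  have -> : (eps_ j * hp p.+1)`_p = \sum_(0 <= l < p.+1) (eps_ j)`_l * compl_int (p%:Z - l%:Z).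
    rewrite coefM big_mkord; apply: eq_bigr => l _; have ltl := ltn_ord l.
    by rewrite coef_poly ifT ?subzn //; lia.
  have tail a b : (a <= b)%N -> (forall l, (a <= l)%N -> (eps_ j)`_l * compl_int (p%:Z - l%:Z) = 0) ->
    \sum_(0 <= l < b) (eps_ j)`_l * compl_int (p%:Z - l%:Z) =
    \sum_(0 <= l < a) (eps_ j)`_l * compl_int (p%:Z - l%:Z).
    move=> leab vanish; rewrite (big_cat_nat (leq0n a) leab) /=.
    rewrite [X in _ + X]big_nat_cond [X in _ + X]big1 ?addr0 // => l; rewrite andbT.
    by case/andP=> lel _; apply: vanish.
  rewrite -(big_mkord predT (fun l => (eps_ j)`_l * compl_int (p%:Z - l%:Z))).
  have [lepn|/ltnW lenp] := leqP p n; [apply/esym|]; apply: tail => // l lel.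
    have -> : (p%:Z - l%:Z) = Negz (l - p).-1 by lia.
    by rewrite mulr0.
  by rewrite nth_default ?mul0r // (leq_trans sz_eps).
rewrite (reindex_inj rev_ord_inj); apply: eq_bigr => l _; have ltl := ltn_ord l.
by rewrite mulrC /= subSS; congr (compl_int _ * _); lia.
Qed.

Definition alternant (mu : 'I_n.+1 -> nat) : R :=
  \det (\matrix_(i, j) z j ^+ (mu i + (n - i))).

(** By [power_compl] the matrix of powers is the matrix of complete functions times
a matrix that does not depend on mu; for mu = 0 the former is unitriangular. *)
Lemma jacobi_trudi (mu : 'I_n.+1 -> nat) :
  alternant mu =
  alternant (fun=> 0%N) * \det (\matrix_(i, j) compl_int ((mu i)%:Z - i%:Z + j%:Z)).
Proof.
pose M : 'M[R]_n.+1 := \matrix_(l, j) (eps_ j)`_(n - l).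
pose Hm (al : 'I_n.+1 -> nat) : 'M[R]_n.+1 :=
  \matrix_(i, j) compl_int ((al i)%:Z - i%:Z + j%:Z).
have fact al : alternant al = \det (Hm al) * \det M.
  rewrite -det_mulmx; congr (\det _); apply/matrixP => i j; rewrite !mxE power_compl.
  apply: eq_bigr => l _; rewrite !mxE; congr (compl_int _ * _).
  by have := ltn_ord i; lia.
have Hm0 : \det (Hm (fun=> 0%N)) = 1.
  rewrite -det_tr det_trig; last first.
    apply/is_trig_mxP => i j ltij; rewrite !mxE.
    by have -> : (0 - j%:Z + i%:Z) = Negz (j - i).-1 by lia.
  rewrite big1 // => i _; rewrite !mxE.
  by rewrite sub0r addrC subrr.
by rewrite (fact mu) (fact (fun=> 0%N)) Hm0 mul1r mulrC.
Qed.
End Alphabet.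

(** * Colourings fixed by a product of cycles *)

Section BlockWord.

Fixpoint chain_word (a : nat) (mu : seq nat) : seq nat :=
  if mu is k :: mu' then iota a k.-1 ++ chain_word (a + k) mu' else [::].

(** A letter i of the product of cycles joins i and i + 1 inside a block. *)
Lemma mem_chain_word a mu i : (a <= i)%N ->
  (i \in chain_word a mu) =
  (i.+1 < a + sumn mu)%N && (block_start a mu i.+1 == block_start a mu i).
Proof.
elim: mu a => [|k mu IHmu] a leai /=; first by rewrite addn0 in_nil; lia.
rewrite mem_cat mem_iota leai /=; have [lti|lei] := ltnP i (a + k.-1).
  by rewrite !ifT ?eqxx //; lia.
have [ltk|lek] := ltnP i.+1 (a + k); first by lia.
have [ltk'|lek'] := ltnP i (a + k).
  have /andP[lb _] := block_start_bounds mu lek.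
  have -> : (block_start (a + k) mu i.+1 == a) = false by lia.
  rewrite andbF; apply: contraTF ltk'; rewrite -leqNgt.
  elim: (mu) (a + k)%N => //= l mu' IH b; rewrite mem_cat mem_iota => /orP[/andP[]|/IH] //.
  by lia.
by rewrite IHmu // addnA.
Qed.

Lemma chain_word_ge a mu i : i \in chain_word a mu -> (a <= i)%N.
Proof.
elim: mu a => //= k mu IHmu a; rewrite mem_cat mem_iota => /orP[/andP[]|/IHmu] //.
by lia.
Qed.

Lemma sorted_chain_word a mu : sorted ltn (chain_word a mu).
Proof.
elim: mu a => //= k mu IHmu a; rewrite sorted_pairwise; last exact: ltn_trans.
rewrite pairwise_cat -!sorted_pairwise ?IHmu ?iota_ltn_sorted ?andbT //; try exact: ltn_trans.
by apply/allrelP => i j; rewrite mem_iota => /andP[lea lti] /chain_word_ge; lia.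
Qed.

Lemma size_chain_word a mu : size (chain_word a mu) = (\sum_(k <- mu) k.-1)%N.
Proof.
by elim: mu a => [|k mu IHmu] a; rewrite ?big_nil // big_cons /= size_cat size_iota IHmu.
Qed.

Lemma chain_wordE (K : fieldType) (A : algType K) (T : nat -> A) a mu :
  chains T a mu = \prod_(i <- chain_word a mu) T i.
Proof.
elim: mu a => [|k mu IHmu] a /=; first by rewrite big_nil.
rewrite big_cat IHmu; congr (_ * _).
by elim: k.-1 a => [|l IHl] b /=; rewrite ?big_nil // big_cons IHl.
Qed.

Lemma take_reshape_index a mu x : (x < sumn mu)%N ->
  (a + sumn (take (reshape_index mu x) mu))%N = block_start a mu (a + x).
Proof.
elim: mu a x => //= k mu IHmu a x ltx; rewrite reshape_index_cons ltn_add2l.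
case: ltnP => [|lekx] //=; first by rewrite addn0.
by rewrite addnA IHmu; [congr block_start|]; lia.
Qed.

Lemma reshape_index_take mu i : 0%N \notin mu -> (i < size mu)%N ->
  reshape_index mu (sumn (take i mu)) = i.
Proof.
elim: mu i => //= k mu IHmu [|i] /=; rewrite inE negb_or => /andP[k0 mu0] lti.
  by rewrite reshape_index_cons ifT // lt0n eq_sym.
by rewrite reshape_index_cons ltnNge leq_addr addKn IHmu.
Qed.

Lemma reshape_index_lt mu x : (x < sumn mu)%N -> (reshape_index mu x < size mu)%N.
Proof.
elim: mu x => //= k mu IHmu x ltx; rewrite reshape_index_cons.
have [//|lekx] := ltnP x k.
by rewrite -[(_ < (size mu).+1)%N]/(reshape_index mu (x - k) < size mu)%N IHmu //; lia.
Qed.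

Lemma prod_reshape_index (R : comNzRingType) (G : nat -> R) mu :
  \prod_(0 <= x < sumn mu) G (reshape_index mu x) =
  \prod_(0 <= i < size mu) G i ^+ nth 0%N mu i.
Proof.
elim: mu G => [|k mu IHmu] G; first by rewrite !big_geq.
rewrite [sumn _]/= [size _]/= (big_cat_nat (n := k)) ?leq_addr //= big_nat_recl //=.
congr (_ * _).
  rewrite (eq_big_nat _ _ (F2 := fun=> G 0%N)) => [|x /andP[_ ltx]].
    by rewrite big_const_nat subn0 iter_mulr_1.
  by rewrite reshape_index_cons ltx.
rewrite -[X in \prod_(X <= _ < _) _]add0n big_addn addKn.
rewrite -(IHmu (fun i => G i.+1)); apply: eq_big_nat => x _.
by rewrite reshape_index_cons ifF ?addnK //; lia.
Qed.
End BlockWord.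

Section Colourings.
Variable n : nat.
Local Notation colouring := {ffun 'I_n.+1 -> 'I_n.+1}.
Local Notation Z := {mpoly algC[n.+1]}.
Implicit Types (f : colouring) (g : 'S_n.+1).

Definition shift_colouring f g : colouring := [ffun x => f (g x)].

Lemma shift_colouringM f g h :
  shift_colouring (shift_colouring f g) h = shift_colouring f (h * g).
Proof. by apply/ffunP => x; rewrite !ffunE permM. Qed.

Definition colour_mon f : Z := \prod_x 'X_(f x).

Lemma colour_mon_shift f g : colour_mon (shift_colouring f g) = colour_mon f.
Proof.
rewrite /colour_mon [RHS](reindex_inj (@perm_inj _ g)).
by apply: eq_bigr => x _; rewrite ffunE.
Qed.

Definition fix_poly g : Z := \sum_(f | shift_colouring f g == f) colour_mon f.

Lemma shift_wperm f w : (forall i, i \in w -> shift_colouring f (stp n i) = f) ->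
  shift_colouring f (wperm n w) = f.
Proof.
elim: w => [|i w IHw] fix_f /=.
  by apply/ffunP => x; rewrite ffunE perm1.
rewrite -shift_colouringM fix_f ?mem_head // IHw // => j j_w.
by rewrite fix_f // inE j_w orbT.
Qed.

(** The letters after i in an increasing word fix i and those before it fix
i + 1. *)
Lemma wperm_sorted w i : sorted ltn w -> all (fun j => j < n)%N w -> i \in w ->
  wperm n w (inord i) = inord i.+1.
Proof.
have stp_lt j (x : 'I_n.+1) : (j < n)%N -> (x < j)%N || (j.+1 < x)%N -> stp n j x = x.
  move=> ltj xj; apply: val_inj; rewrite /= stpE //.
  by case: eqP => [|_]; [lia|case: eqP => //; lia].
have wperm_gt j v (x : 'I_n.+1) : path ltn j v -> all (fun j => j < n)%N v ->
    (x <= j)%N -> wperm n v x = x.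
  elim: v j => [|l v IHv] j /=; first by rewrite perm1.
  case/andP=> ltjl pth /andP[ltl ltv] lexj.
  rewrite permM (IHv l) ?stp_lt //; lia.
elim: w => //= j w IHw pth /andP[ltj ltw]; rewrite inE permM.
have jK : (inord j : 'I_n.+1) = j :> nat by rewrite inordK //; lia.
case/predU1P => [->|i_w]; first by rewrite (wperm_gt j) ?jK // tpermL.
rewrite IHw ?(path_sorted pth) // stp_lt //.
have lti : (i < n)%N by apply: (allP ltw).
have : (j < i)%N by apply: (allP (order_path_min ltn_trans pth)).
by rewrite inordK; lia.
Qed.

(** A colouring is fixed by a product of cycles on consecutive blocks if and only if
it is constant on each block, so it amounts to a choice of one colour per block. *)
Lemma fix_poly_chain (mu : seq nat) : 0%N \notin mu -> sumn mu = n.+1 ->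
  fix_poly (wperm n (chain_word 0 mu)) =
  \prod_(k <- mu) psum (fun i : 'I_n.+1 => 'X_i : Z) k.
Proof.
move=> mu0 def_n; set w := chain_word 0 mu; set st := block_start 0 mu.
have mem_w i : (i \in w) = (i.+1 < n.+1)%N && (st i.+1 == st i).
  by rewrite mem_chain_word // add0n def_n.
have w_lt : all (fun j => j < n)%N w by apply/allP => i; rewrite mem_w => /andP[].
have st_le p : (st p <= p)%N by have /andP[] := block_start_bounds mu (leq0n p).
have st_const p y : (st p <= y <= p)%N -> st y = st p by apply: block_start_const.
pose bi x := reshape_index mu x.
have bi_lt (x : 'I_n.+1) : (bi x < size mu)%N.
  by apply: reshape_index_lt; rewrite def_n.
have st_bi x : (x < n.+1)%N -> sumn (take (bi x) mu) = st x.
  by move=> ltx; rewrite -[LHS]add0n take_reshape_index ?def_n.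
case def_l: (size mu) => [|l]; first by case: (mu) def_l def_n.
(* A block gets its colour back from its first point. *)
pose h (phi : {ffun 'I_l.+1 -> 'I_n.+1}) : colouring := [ffun x : 'I_n.+1 => phi (inord (bi x))].
pose h' f : {ffun 'I_l.+1 -> 'I_n.+1} := [ffun i : 'I_l.+1 => f (inord (sumn (take i mu)))].
rewrite /fix_poly (reindex_onto h h') => /= [|f /eqP fix_f]; last first.
  apply/ffunP => x; rewrite !ffunE inordK -?def_l ?bi_lt // st_bi //.
  have const_f i : i \in w -> f (inord i) = f (inord i.+1).
    move=> i_w; rewrite -{1}fix_f ffunE wperm_sorted //; exact: sorted_chain_word.
  have eq_f y : (st x <= y <= x)%N -> f (inord (st x)) = f (inord y).
    elim: y => [|y IHy]; first by rewrite leqn0 => /andP[/eqP->].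
    case/andP; rewrite leq_eqVlt => /predU1P[->//|lty] ltyx.
    rewrite -const_f ?IHy //; first by lia.
    rewrite mem_w; have ltx := ltn_ord x.
    by rewrite !(@st_const x) ?eqxx ?andbT //; lia.
  by rewrite (eq_f x) ?inord_val // st_le /=.
have biE phi (x : 'I_n.+1) : h phi x = phi (inord (bi x)) by rewrite ffunE.
transitivity (\sum_(phi : {ffun 'I_l.+1 -> 'I_n.+1}) \prod_i 'X_(phi i) ^+ nth 0%N mu i : Z).
  apply: eq_big => [phi|phi _].
    apply/andP; split; apply/eqP.
      apply: shift_wperm => i; rewrite mem_w => /andP[lti /eqP eqst].
      apply/ffunP => x; rewrite !ffunE; congr (phi (inord _)); apply/eqP.
      rewrite -(block_start_eq 0) ?def_n // !add0n -/st stpE //.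
      by case: (x =P i :> nat) => [->|_]; [|case: (x =P i.+1 :> nat) => [->|_]]; rewrite ?eqst.
    apply/ffunP => i; rewrite !ffunE; congr (phi _); apply: val_inj => /=.
    have lti : (i < size mu)%N by rewrite def_l.
    rewrite [nat_of_ord (inord (sumn _))]inordK.
      by rewrite /bi reshape_index_take // inordK -?def_l.
    rewrite -def_n -{2}(cat_take_drop i mu) sumn_cat (drop_nth 0%N lti) /=.
    have : nth 0%N mu i != 0%N by apply: contraNneq mu0 => <-; apply: mem_nth.
    by lia.
  rewrite /colour_mon; under eq_bigr => x _ do rewrite biE.
  rewrite -(big_mkord predT (fun x => 'X_(phi (inord (bi x))))).
  have := prod_reshape_index (fun i => 'X_(phi (inord i)) : Z) mu.
  rewrite def_n def_l big_mkord => ->; rewrite big_mkord.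
  by apply: eq_bigr => i _; rewrite inord_val.
rewrite -(bigA_distr_bigA (fun (i : 'I_l.+1) c => 'X_c ^+ nth 0%N mu i)).
by rewrite [RHS](big_nth 0%N) def_l big_mkord.
Qed.
End Colourings.

(** * Averages of the colouring trace over Young subgroups *)

Section ColouringTrace.
Variable n : nat.
Local Notation colouring := {ffun 'I_n.+1 -> 'I_n.+1}.
Local Notation Z := {mpoly algC[n.+1]}.
Local Notation d := #|{: colouring}|.-1.
Local Notation A := 'M[algC]_d.+1.
Implicit Types (f : colouring) (g : 'S_n.+1).

Fact card_colouring : #|{: colouring}| = d.+1.
Proof. by rewrite prednK // card_ffun card_ord expn_gt0. Qed.

Definition colour_at (a : 'I_d.+1) : colouring :=
  enum_val (cast_ord (esym card_colouring) a).
Definition colour_index f : 'I_d.+1 := cast_ord card_colouring (enum_rank f).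

Lemma colour_indexK : cancel colour_index colour_at.
Proof. by move=> f; rewrite /colour_at /colour_index cast_ordK enum_rankK. Qed.
Lemma colour_atK : cancel colour_at colour_index.
Proof. by move=> a; rewrite /colour_at /colour_index enum_valK cast_ordKV. Qed.

(** The permutation representation of the symmetric group on colourings. *)
Definition colour_mx g : A :=
  \matrix_(a, b) (shift_colouring (colour_at a) g == colour_at b)%:R.

Lemma colour_mxM g h : colour_mx g * colour_mx h = colour_mx (h * g).
Proof.
apply/matrixP => a b; rewrite !mxE.
rewrite (bigD1 (colour_index (shift_colouring (colour_at a) g))) //=.
rewrite big1 ?addr0 => [|c neqc]; rewrite !mxE.
  by rewrite colour_indexK eqxx mul1r shift_colouringM.
have /negbTE-> : shift_colouring (colour_at a) g != colour_at c.
  by apply: contraNneq neqc => ->; rewrite colour_atK.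
by rewrite mul0r.
Qed.

Lemma colour_mx1 : colour_mx 1 = 1.
Proof.
apply/matrixP => a b; rewrite !mxE -(inj_eq (can_inj colour_atK)).
congr (_ == _)%:R; by apply/ffunP => x; rewrite ffunE perm1.
Qed.

(** The trace weighted by the monomial of a colouring; the weight is invariant under
permutation of the points. *)
Definition weight_trace (x : A) : Z := \sum_a x a a *: colour_mon (colour_at a).

Fact weight_trace_linear : linear weight_trace.
Proof.
move=> c x y; rewrite /weight_trace scaler_sumr -big_split.
by apply: eq_bigr => a _; rewrite !mxE scalerDl scalerA.
Qed.
HB.instance Definition _ :=
  GRing.isLinear.Build algC A Z _ weight_trace weight_trace_linear.

Lemma weight_traceC g x : weight_trace (colour_mx g * x) = weight_trace (x * colour_mx g).
Proof.
rewrite /weight_trace; under eq_bigr => a _ do rewrite mxE scaler_suml.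
under [RHS]eq_bigr => a _ do rewrite mxE scaler_suml.
rewrite exchange_big; apply: eq_bigr => a _; apply: eq_bigr => b _.
rewrite !mxE; case: eqP => [<-|_]; last by rewrite mul0r mulr0 !scale0r.
by rewrite colour_mon_shift mulrC.
Qed.

Lemma weight_trace_mx g : weight_trace (colour_mx g) = fix_poly g.
Proof.
rewrite /weight_trace /fix_poly [RHS]big_mkcond.
rewrite [RHS](reindex_onto colour_at colour_index) => [|f _]; last exact: colour_indexK.
apply: eq_big => [a|a _]; first by rewrite colour_atK eqxx.
by rewrite mxE; case: eqP => _; rewrite ?scale1r ?scale0r.
Qed.

Section Signed.
Variable c : algC.
Hypothesis cc : c * c = 1.

(** The signs c = 1 and c = -1 give the colouring module and its twist by the sign
character; both satisfy the relations with q = 1. *)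
Definition colour_gen (i : nat) : A := c *: colour_mx (stp n i).

Lemma colour_gen_rels : hecke_rels 1 colour_gen n.+1.
Proof.
rewrite /colour_gen; split=> [i _|i lti|i j ltij ltj].
- rewrite invr1 subrr scale0r add0r -scalerAl -scalerAr scalerA cc scale1r.
  by rewrite colour_mxM /stp tperm2 colour_mx1.
- rewrite -!scalerAl -!scalerAr -!scalerAl; do 3!congr (_ *: _).
  rewrite !colour_mxM; congr colour_mx; apply/permP => x.
  apply: val_inj; rewrite /= !permM !stpE //; try lia.
  by do !case: eqP => //; lia.
rewrite -!scalerAl -!scalerAr; do 2!congr (_ *: _).
rewrite !colour_mxM; congr colour_mx; apply/permP => x.
by apply: val_inj; rewrite /= !permM !stpE //; try lia; do !case: eqP => //; lia.
Qed.

Lemma prod_colour_gen w : \prod_(i <- w) colour_gen i = c ^+ size w *: colour_mx (wperm n w).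
Proof.
elim: w => [|i w IHw] /=; first by rewrite big_nil scale1r colour_mx1.
by rewrite big_cons IHw -scalerAl -scalerAr scalerA colour_mxM exprS.
Qed.

Lemma sgn_wperm w : all (fun i => i < n)%N w -> c ^+ size w = c ^+ odd_perm (wperm n w).
Proof.
have c_odd k : c ^+ k = c ^+ odd k.
  elim: k => //= k IHk; rewrite exprS IHk; case: odd => //=.
  by rewrite mulr1.
rewrite c_odd => w_lt; congr (c ^+ nat_of_bool _).
elim: w w_lt => [|i w IHw] /=; first by rewrite odd_perm1.
case/andP=> lti /IHw ->; rewrite odd_permM odd_tperm addbC.
suff -> : (inord i != inord i.+1 :> 'I_n.+1) by [].
by rewrite -val_eqE /= !inordK; lia.
Qed.

(** At q = 1 the idempotent of nu is the mean over the Young subgroup, and Newton's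
identities are the recursion of [block_trace_of_chains]. *)
Lemma block_average nu (s : nat -> Z) : sumn nu = n.+1 -> s 0%N = 1 ->
  (forall k, k.+1%:R * s k.+1 = \sum_(j < k.+1) s (k - j)%N *
     (c ^+ j *: psum (fun i : 'I_n.+1 => 'X_i : Z) j.+1)) ->
  #|young_set n.+1 nu|%:R^-1 *:
    (\sum_(g in young_set n.+1 nu) c ^+ odd_perm g *: fix_poly g) =
  \prod_(k <- nu) s k.
Proof.
move=> nu_n s0 s_rec; set st := block_start 0 nu.
have st_le p : (st p <= p)%N by have /andP[] := block_start_bounds nu (leq0n p).
have st_const p y : (st p <= y <= p)%N -> st y = st p by apply: block_start_const.
have qint1 k : qint (1 : algC) k = k%:R.
  by rewrite /qint; under eq_bigr do rewrite expr1n; rewrite sumr_const card_ord.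
have qint0 k : qint (1 : algC) k.+1 != 0 by rewrite qint1 pnatr_eq0.
have FC i x : (i.+1 < n.+1)%N ->
    weight_trace (colour_gen i * x) = weight_trace (x * colour_gen i).
  by move=> _; rewrite -scalerAl -scalerAr !linearZ /= weight_traceC.
pose g k : Z := c ^+ k.-1 *: psum (fun i : 'I_n.+1 => 'X_i : Z) k.
have rec k : (k < n.+1)%N -> qint (1 : algC) k.+1 *: s k.+1 =
    \sum_(j < k.+1) 1 ^+ j *: (s (k - j)%N * g j.+1).
  move=> _; rewrite qint1 scaler_nat -mulr_natl s_rec.
  by apply: eq_bigr => j _; rewrite expr1n scale1r.
have of_chains mu : 0%N \notin mu -> sumn mu = n.+1 ->
    block_trace 1 colour_gen weight_trace [::] mu = \prod_(k <- mu) g k.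
  move=> mu0 mu_n; rewrite /block_trace /= mul1r chain_wordE prod_colour_gen.
  rewrite linearZ /= weight_trace_mx fix_poly_chain // size_chain_word.
  elim: (mu) => [|k mu' IH]; first by rewrite !big_nil scale1r.
  by rewrite !big_cons exprD -IH -scalerAl -scalerAr scalerA.
have := block_trace_of_chains (oner_neq0 _) colour_gen_rels qint0 FC s0 rec of_chains.
move/(_ nu [::] isT); rewrite addn0 big_nil mulr1 => /(_ nu_n) <-.
rewrite /block_trace /= mulr1.
have q_fact : \prod_(k <- nu) qfact (1 : algC) k = #|young_set n.+1 nu|%:R.
  rewrite (prod_qfact_words nu_n); under eq_bigr do rewrite expr1n mulr1.
  rewrite [LHS](words_sum st_le st_const (fun=> 1) (leqnn n.+1)) block_perms_young //.
  by rewrite sumr_const.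
have q_fact0 : \prod_(k <- nu) qfact (1 : algC) k != 0.
  by rewrite q_fact pnatr_eq0 -lt0n (cardG_gt0 (young_group n.+1 nu)).
apply: (scalerI q_fact0); apply/esym.
transitivity (weight_trace ((\prod_(k <- nu) qfact 1 k) *: sym_idems 1 colour_gen 0 nu)).
  by rewrite [RHS]linearZ.
rewrite -symmetrizers_idems // (symmetrizers_words nu_n) linear_sum.
rewrite q_fact scalerA divff -?q_fact // scale1r -block_perms_young //.
rewrite -(words_sum st_le st_const (fun g => c ^+ odd_perm g *: fix_poly g) (leqnn n.+1)).
rewrite big_seq [RHS]big_seq; apply: eq_bigr => w w_in.
rewrite expr1n scale1r prod_colour_gen linearZ /= weight_trace_mx.
by rewrite sgn_wperm // (words_ltn w_in).
Qed.
End Signed.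

Lemma compl_average nu : sumn nu = n.+1 ->
  #|young_set n.+1 nu|%:R^-1 *: (\sum_(g in young_set n.+1 nu) fix_poly g) =
  \prod_(k <- nu) compl (fun i : 'I_n.+1 => 'X_i : Z) k.
Proof.
move=> nu_n; rewrite -(block_average (c := 1)) ?mulr1 //.
  by congr (_ *: _); apply: eq_bigr => g _; rewrite expr1n scale1r.
move=> k; rewrite newton_compl; apply: eq_bigr => j _.
by rewrite expr1n scale1r.
Qed.

Lemma elem_average nu : sumn nu = n.+1 ->
  #|young_set n.+1 nu|%:R^-1 *:
    (\sum_(g in young_set n.+1 nu) (-1) ^+ odd_perm g *: fix_poly g) =
  \prod_(k <- nu) elem (fun i : 'I_n.+1 => 'X_i : Z) k.
Proof.
move=> nu_n; rewrite -(block_average (c := -1)) ?mulrNN ?mulr1 //.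
  by rewrite /elem expr0 mul1r alt_elem0.
move=> k; rewrite newton_elem; apply: eq_bigr => j _.
by rewrite -mul_mpolyC rmorph_sign.
Qed.
End ColouringTrace.

(** * Scalar products of induced sign and trivial characters *)

Section InducedSign.
Variable n : nat.
Local Notation colouring := {ffun 'I_n.+1 -> 'I_n.+1}.
Local Notation Z := {mpoly algC[n.+1]}.
Local Notation Sn := [set: 'S_n.+1].
Implicit Types (f : colouring) (g : 'S_n.+1) (m : 'X_{1..n.+1}).

Lemma cfsignE (G : {group 'S_n.+1}) g :
  cfsign G g = if g \in G then (-1) ^+ odd_perm g else 0.
Proof. by rewrite /cfsign cfunElock. Qed.

(** The number of points of each colour. *)
Definition content f : 'X_{1..n.+1} := (\sum_x U_(f x))%MM.

Lemma colour_monE f : colour_mon f = 'X_[content f].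
Proof. by rewrite /colour_mon mprodXE. Qed.

Lemma contentE f i : content f i = #|[pred x | f x == i]|.
Proof.
rewrite mnm_sumE -sum1_card [RHS]big_mkcond; apply: eq_bigr => x _.
by rewrite mnm1E inE; case: eqP.
Qed.

Lemma content_shift f g : content (shift_colouring f g) = content f.
Proof.
apply/mnmP => i; rewrite !mnm_sumE [RHS](reindex_inj (@perm_inj _ g)).
by apply: eq_bigr => x _; rewrite ffunE.
Qed.

Lemma content_eqP f f' : content f = content f' -> exists g, shift_colouring f g = f'.
Proof.
move=> eq_c; have : perm_eq [tuple f' x | x < n.+1] [tuple f x | x < n.+1].
  apply/allP => i _ /=; apply/eqP; rewrite !count_map -enumT.
  have cnt (h : colouring) : count (preim h (pred1 i)) (enum 'I_n.+1) = content h i.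
    by rewrite contentE cardE -size_filter /enum_mem -filter_predI; congr size;
       apply: eq_filter => x; rewrite !inE andbT.
  by transitivity (content f' i); [exact: cnt | rewrite -eq_c; apply/esym/cnt].
case/tuple_permP => g def_f'; exists g; apply/ffunP => x; rewrite ffunE.
have := congr1 (fun t => nth ord0 t x) def_f'.
by rewrite -!tnth_nth !tnth_mktuple.
Qed.

Lemma fix_poly_coef g m :
  (fix_poly g)@_m = \sum_(f | shift_colouring f g == f) (content f == m)%:R.
Proof.
rewrite /fix_poly raddf_sum; apply: eq_bigr => f _ /=.
by rewrite colour_monE mcoeffX.
Qed.

Section Content.
Variable m : 'X_{1..n.+1}.
Hypothesis deg_m : mdeg m = n.+1.

Lemma sumn_mnm : sumn m = n.+1.
Proof. by rewrite -[RHS]deg_m sumnE. Qed.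

(** The colouring by blocks, whose stabiliser is the Young subgroup. *)
Definition std_colouring : colouring := [ffun x : 'I_n.+1 => inord (reshape_index m x)].
Local Notation f0 := std_colouring.

Lemma std_colouringE x : f0 x = reshape_index m x :> nat.
Proof.
rewrite ffunE inordK //; have := @reshape_index_lt m x.
by rewrite size_tuple sumn_mnm; apply.
Qed.

Lemma content_std : content f0 = m.
Proof.
suff eq_mon : colour_mon f0 = 'X_[m].
  have := congr1 (mcoeff m) eq_mon; rewrite colour_monE !mcoeffX eqxx.
  by case: eqP => // _ /eqP; rewrite eq_sym oner_eq0.
rewrite /colour_mon mpolyXE_id.
transitivity (\prod_(0 <= x < n.+1) ('X_(inord (reshape_index m x)) : Z)).
  by rewrite big_mkord; apply: eq_bigr => x _; rewrite ffunE.
have := prod_reshape_index (fun i => 'X_(inord i) : Z) m.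
rewrite sumn_mnm size_tuple => ->; rewrite big_mkord.
by apply: eq_bigr => i _; rewrite inord_val (mnm_nth 0).
Qed.

Lemma mem_young_std g : (g \in young_set n.+1 m) = (shift_colouring f0 g == f0).
Proof.
rewrite inE; apply/forallP/eqP => [gP|fixg x].
  by apply/ffunP => x; apply: val_inj; rewrite /= ffunE !std_colouringE; apply/eqP.
have := congr1 (fun h : colouring => h x) fixg; rewrite /shift_colouring ffunE => fixgx.
by rewrite -!std_colouringE fixgx.
Qed.

(** Permutations that carry the standard colouring to f form a coset of its
stabiliser, or the empty set if f has another content. *)
Lemma card_shift_std f :
  #|[set g | shift_colouring f0 g == f]| = ((content f == m) * #|young_set n.+1 m|)%N.
Proof.
have [eq_c|ne_c] := eqVneq (content f) m; last first.
  rewrite mul0n; apply/eqP; rewrite cards_eq0; apply/eqP/setP => g; rewrite !inE.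
  by apply: contraNF ne_c => /eqP<-; rewrite content_shift content_std.
have [|g0 <-] := @content_eqP f0 f; first by rewrite eq_c content_std.
rewrite mul1n -(card_lcoset (young_group n.+1 m) g0); apply: eq_card => g.
rewrite mem_lcoset inE mem_young_std.
have inj_g0 : injective (fun h : colouring => shift_colouring h g0).
  move=> f1 f2 eq_f; apply/ffunP => x.
  have := congr1 (fun h : colouring => h (g0^-1%g x)) eq_f.
  by rewrite /shift_colouring !ffunE permKV.
by rewrite -[RHS](inj_eq inj_g0) shift_colouringM mulKVg.
Qed.

(** The module induced from a Young subgroup is the module of the colourings with the
corresponding content, up to the sign twist. *)
Lemma ind_sign_coef g :
  'Ind[Sn, young_group n.+1 m] (cfsign (young_group n.+1 m)) g =
  (-1) ^+ odd_perm g * (fix_poly g)@_m.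
Proof.
rewrite cfIndE ?subsetT // fix_poly_coef.
have -> : \sum_(y in Sn) cfsign (young_group n.+1 m) (g ^ y)%g =
    (-1) ^+ odd_perm g * \sum_(y : 'S_n.+1)
      (shift_colouring (shift_colouring f0 y) g == shift_colouring f0 y)%:R.
  rewrite mulr_sumr; apply: eq_big => [y|y _]; first by rewrite inE.
  rewrite cfsignE -[_ \in _]/((g ^ y)%g \in young_set n.+1 m) mem_young_std.
  have -> : (shift_colouring f0 (g ^ y)%g == f0) =
      (shift_colouring (shift_colouring f0 y) g == shift_colouring f0 y).
    rewrite shift_colouringM conjgE; apply/eqP/eqP => fixf.
      by have := congr1 (fun h : colouring => shift_colouring h y) fixf; rewrite shift_colouringM mulKVg.
    have := congr1 (fun h : colouring => shift_colouring h y^-1%g) fixf; rewrite !shift_colouringM mulVg.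
    by move=> ->; apply/ffunP => x; rewrite [LHS]ffunE perm1.
  by rewrite odd_permJ; case: ifP; rewrite ?mulr1 ?mulr0.
rewrite mulrCA; congr (_ * _).
rewrite (partition_big (fun y => shift_colouring f0 y) predT) //=.
rewrite mulr_sumr [RHS]big_mkcond; apply: eq_bigr => f _.
rewrite (eq_bigr (fun=> (shift_colouring f g == f)%:R)) => [|y /eqP-> //].
rewrite sumr_const -[#|_|]/(#|[pred y | shift_colouring f0 y == f]|).
have := card_shift_std f; rewrite cardsE => ->.
case: (_ == f); last by rewrite mul0rn mulr0.
case: (_ == m); last by rewrite mulr0.
by rewrite mul1n mulVf // pnatr_eq0 -lt0n (cardG_gt0 (young_group n.+1 m)).
Qed.

(** By reciprocity this is the mean over S_nu of a coefficient of the signed colouring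
polynomial. *)
Lemma cfdot_sign_triv nu : sumn nu = n.+1 ->
  '['Ind[Sn, young_group n.+1 m] (cfsign _), 'Ind[Sn, young_group n.+1 nu] 1] =
  (\prod_(k <- nu) elem (fun i : 'I_n.+1 => 'X_i : Z) k)@_m.
Proof.
move=> nu_n; rewrite -cfdot_Res_l cfdotE -elem_average // mcoeffZ raddf_sum /=.
congr (_ * _); apply: eq_bigr => g g_in.
rewrite cfResE ?subsetT // cfun1E g_in conjC1 mulr1 ind_sign_coef.
by rewrite mcoeffZ.
Qed.

Lemma cfdot_sign_sign nu : sumn nu = n.+1 ->
  '['Ind[Sn, young_group n.+1 m] (cfsign _), 'Ind[Sn, young_group n.+1 nu] (cfsign _)] =
  (\prod_(k <- nu) compl (fun i : 'I_n.+1 => 'X_i : Z) k)@_m.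
Proof.
move=> nu_n; rewrite -cfdot_Res_l cfdotE -compl_average // mcoeffZ raddf_sum /=.
congr (_ * _); apply: eq_bigr => g g_in.
rewrite cfResE ?subsetT // ind_sign_coef cfsignE g_in.
by rewrite rmorph_sign mulrAC -signr_addb addbb mul1r.
Qed.
End Content.
End InducedSign.

(** * Exponents, alternants and leading monomials *)

Lemma mcoeff_mulX n (R : comNzRingType) (p : {mpoly R[n]}) (a m : 'X_{1..n}) :
  ('X_[a] * p)@_m = if (a <= m)%MM then p@_(m - a) else 0.
Proof.
case: ifP => le_am; first by rewrite -{1}(submK le_am) addmC mulrC mcoeffMX.
rewrite [p]mpolyE mulr_sumr raddf_sum big1 // => b _ /=.
rewrite -scalerAr mcoeffZ -mpolyXD mcoeffX; case: eqP => [def_m|]; last by rewrite mulr0.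
by case/negP: le_am; rewrite -def_m lem_addr.
Qed.

Section Alternants.
Variables (n : nat) (R : comNzRingType).
Local Notation Z := {mpoly R[n.+1]}.
Local Notation X := (fun i : 'I_n.+1 => 'X_i : Z).
Implicit Types (la al : 'X_{1..n.+1}).

Lemma elem_mesym k : elem X k = mesym n.+1 R k.
Proof.
rewrite /elem /alt_elem.
under eq_bigr => i _ do rewrite addrC.
rewrite (bigA_distr _ _ (fun i : 'I_n.+1 => - ((X i)%:P * 'X)) (fun=> 1)).
have termE (J : {set 'I_n.+1}) :
    \prod_i (if i \in J then - ((X i)%:P * 'X) else 1) =
    ((-1) ^+ #|J| * \prod_(i in J) X i)%:P * 'X^#|J| :> {poly Z}.
  rewrite -big_mkcond /= (eq_bigr (fun i => (- X i)%:P * 'X)) => [|i _].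
    by rewrite big_split prodr_const -rmorph_prod prodrN.
  by rewrite polyCN mulNr.
under eq_bigr => J _ do rewrite termE.
rewrite coef_sum mulr_sumr /mesym [RHS]big_mkcond; apply: eq_bigr => J _.
rewrite coefCM coefXn; case: (eqVneq #|J| k) => [->|ne].
  by rewrite ?eqxx mulr1 mulrA -expr2 sqrr_sign mul1r.
by rewrite !mulr0.
Qed.

(** The exponents n, n - 1, ..., 0, permuted. *)
Definition delta_mnm (s : 'S_n.+1) : 'X_{1..n.+1} := [multinom (n - s i)%N | i < n.+1].
(** The exponent la + delta. *)
Definition staircase la : 'X_{1..n.+1} := (la + delta_mnm 1)%MM.

Lemma staircaseE la i : staircase la i = (la i + (n - i))%N.
Proof. by rewrite mnmDE mnmE perm1. Qed.

Lemma alternantE la : alternant X la =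
  \sum_(s : 'S_n.+1) (-1) ^+ s *: 'X_[[multinom staircase la (s i) | i < n.+1]].
Proof.
rewrite /alternant -det_tr; apply: eq_bigr => s _.
rewrite -mul_mpolyC rmorph_sign mpolyXE_id; congr (_ * _).
by apply: eq_bigr => i _; rewrite !mxE mnmE staircaseE.
Qed.

Lemma alternant0E : alternant X (fun=> 0%N) = \sum_(s : 'S_n.+1) (-1) ^+ s *: 'X_[delta_mnm s].
Proof.
rewrite /alternant -det_tr; apply: eq_bigr => s _.
rewrite -mul_mpolyC rmorph_sign mpolyXE_id; congr (_ * _).
by apply: eq_bigr => i _; rewrite !mxE mnmE add0n.
Qed.

Definition jt_nonneg la (s : 'S_n.+1) := [forall i : 'I_n.+1, (i <= la i + s i)%N].
(** The exponent la_i - i + s(i) of a term of the Jacobi-Trudi determinant; the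
truncated subtraction is exact under [jt_nonneg]. *)
Definition jt_exponent la (s : 'S_n.+1) : 'X_{1..n.+1} :=
  [multinom (la i + s i - i)%N | i < n.+1].

(** The same alternating sum appears in the expansion of a determinant with entries
indexed by la_i - i + j, see [det_jt]; this turns scalar products with such
determinants into single coefficients. *)
Lemma mcoeff_alternant0 (f : Z) la :
  (alternant X (fun=> 0%N) * f)@_(staircase la) =
  \sum_(s | jt_nonneg la s) (-1) ^+ s * f@_(jt_exponent la s).
Proof.
rewrite alternant0E mulr_suml raddf_sum [RHS]big_mkcond; apply: eq_bigr => s _ /=.
rewrite -scalerAl mcoeffZ mcoeff_mulX.
have -> : (delta_mnm s <= staircase la)%MM = jt_nonneg la s.
  apply/mnm_lepP/forallP => les i; have := les i; rewrite staircaseE mnmE.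
    by have := ltn_ord i; have := ltn_ord (s i); lia.
  by have := ltn_ord i; have := ltn_ord (s i); lia.
case: ifP => [/forallP ok|]; rewrite ?mulr0 //; congr (_ * _@__).
apply/mnmP => i; rewrite mnmBE staircaseE [delta_mnm s i]mnmE [RHS]mnmE.
by have := ok i; have := ltn_ord i; have := ltn_ord (s i); lia.
Qed.

Lemma mdeg_jt_exponent la s : jt_nonneg la s -> mdeg (jt_exponent la s) = mdeg la.
Proof.
move=> /forallP ok; rewrite !mdegE; apply: (@addIn (\sum_(i < n.+1) i)%N).
rewrite [X in _ = (_ + X)%N](reindex_inj (@perm_inj _ s)) -!big_split.
by apply: eq_bigr => i _; rewrite /= mnmE subnK.
Qed.

Definition strict al := [forall i : 'I_n.+1, forall j : 'I_n.+1, (i < j)%N ==> (al j < al i)%N].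

Lemma strictP al : reflect (forall i j : 'I_n.+1, (i < j)%N -> (al j < al i)%N) (strict al).
Proof.
apply: (iffP forallP) => [h i j|h i]; first by have /forallP/(_ j)/implyP := h i.
by apply/forallP => j; apply/implyP; apply: h.
Qed.

Lemma strict_perm al be (s : 'S_n.+1) : strict al -> strict be ->
  (forall i, be i = al (s i)) -> s = 1%g.
Proof.
move=> /strictP al_s /strictP be_s eq_be.
(* An increasing permutation satisfies i <= s i <= i. *)
have s_inc (i j : 'I_n.+1) : (i < j)%N -> (s i < s j)%N.
  move=> ltij; have := be_s i j ltij; rewrite !eq_be.
  have [//|ltji|/val_inj/perm_inj eqij] := ltngtP (s i) (s j).
    by have := al_s _ _ ltji; lia.
  by rewrite eqij ltnn in ltij.
have s_ge k : forall i : 'I_n.+1, i = k :> nat -> (k <= s i)%N.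
  elim: k => [|k IHk] i ik //; have ltk : (k < n.+1)%N by have := ltn_ord i; lia.
  have := IHk (Ordinal ltk) erefl; have := s_inc (Ordinal ltk) i; rewrite /=; lia.
have s_le k : forall i : 'I_n.+1, (n - i = k)%N -> (s i <= i)%N.
  elim: k => [|k IHk] i ik; first by have := ltn_ord (s i); have := ltn_ord i; lia.
  have lti : (i.+1 < n.+1)%N by lia.
  have := IHk (Ordinal lti); have := s_inc i (Ordinal lti); rewrite /=; lia.
apply/permP => i; rewrite perm1; apply/val_inj/eqP.
by rewrite eqn_leq (s_le (n - i)%N) // (s_ge i).
Qed.

Definition decreasing la := [forall i : 'I_n.+1, forall j : 'I_n.+1, (i <= j)%N ==> (la j <= la i)%N].

Lemma decreasingP la : reflect (forall i j : 'I_n.+1, (i <= j)%N -> (la j <= la i)%N) (decreasing la).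
Proof.
apply: (iffP forallP) => [h i j|h i]; first by have /forallP/(_ j)/implyP := h i.
by apply/forallP => j; apply/implyP; apply: h.
Qed.

Lemma strict_staircase la : decreasing la -> strict (staircase la).
Proof.
move=> /decreasingP la_d; apply/strictP => i j ltij; rewrite !staircaseE.
by have := la_d i j (ltnW ltij); have := ltn_ord j; lia.
Qed.

Lemma alternant_coef la be : decreasing la -> strict be ->
  (alternant X la)@_be = (be == staircase la)%:R.
Proof.
move=> la_d be_s; rewrite alternantE raddf_sum (bigD1 1%g) //= big1 ?addr0 => [|s s1].
  rewrite odd_perm1 expr0 scale1r mcoeffX eq_sym; congr (_ == _)%:R.
  by apply/mnmP => i; rewrite mnmE perm1.
rewrite mcoeffZ mcoeffX; case: eqP => [def_be|]; last by rewrite mulr0.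
case/eqP: s1; apply: (strict_perm (strict_staircase la_d) be_s) => i.
by rewrite -def_be mnmE.
Qed.

(** At the first point moved by s, its image is larger. *)
Lemma jt_exponent_gt la s : jt_nonneg la s -> s != 1%g -> (la < jt_exponent la s)%O.
Proof.
move=> ok s1; apply/ltmcP; first by rewrite mdeg_jt_exponent.
have [i0 si0] : exists i, s i != i.
  apply/existsP; apply: contraNT s1; rewrite negb_exists => /forallP fix_s.
  by apply/eqP/permP => i; rewrite perm1; apply/eqP; have := fix_s i; rewrite negbK.
case: (@arg_minnP _ i0 (fun i => s i != i) (fun i => nat_of_ord i) si0) => i si i_min.
have fix_lt (j : 'I_n.+1) : (j < i)%N -> s j = j.
  move=> ltji; apply/eqP; apply: contraTT ltji => /i_min; by rewrite leqNgt.
exists i => [j ltji|]; rewrite mnmE; first by rewrite fix_lt // addnK.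
suff : (i < s i)%N by have /forallP/(_ i) := ok; lia.
rewrite ltn_neqAle eq_sym -val_eqE in si *; rewrite si leqNgt; apply/negP => lt_si.
have /perm_inj eq_si := fix_lt _ lt_si.
by rewrite eq_si eqxx in si.
Qed.

Lemma jt_exponent1 la : jt_exponent la 1%g = la.
Proof. by apply/mnmP => i; rewrite mnmE perm1 addnK. Qed.

Lemma jt_nonneg1 la : jt_nonneg la 1%g.
Proof. by apply/forallP => i; rewrite perm1 leq_addl. Qed.

Lemma det_jt (B : comNzRingType) (e : int -> B) la :
    (forall k, e (Negz k) = 0) ->
  \det (\matrix_(i < n.+1, j < n.+1) e ((la i)%:Z - i%:Z + j%:Z)) =
  \sum_(s | jt_nonneg la s) (-1) ^+ s * \prod_(k <- jt_exponent la s) e k%:Z.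
Proof.
move=> eN; rewrite /determinant [RHS]big_mkcond; apply: eq_bigr => s _.
case: ifPn => [/forallP ok|]; last first.
  rewrite negb_forall => /existsP[i lti]; rewrite (bigD1 i) //= mxE.
  have -> : ((la i)%:Z - i%:Z + (s i)%:Z) = Negz (i - la i - s i).-1.
    by move: lti; rewrite -ltnNge; lia.
  by rewrite eN mul0r mulr0.
congr (_ * _); rewrite big_tuple; apply: eq_bigr => i _.
rewrite mxE -mnm_tnth mnmE; congr e.
by have := ok i; lia.
Qed.

(** The leading monomial of e_mu is the conjugate of mu. *)
Lemma mlead_mesyms (mu : seq nat) : all (fun k => k <= n.+1)%N mu ->
  mlead (\prod_(k <- mu) mesym n.+1 R k) =
    [multinom count (fun k => (i < k)%N) mu | i < n.+1] /\
  mleadc (\prod_(k <- mu) mesym n.+1 R k) = 1.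
Proof.
move=> /allP mu_n.
have reg x : x \in mu -> true -> GRing.lreg (mleadc (mesym n.+1 R x)).
  by move=> /mu_n lex _; rewrite mleadc_mesym //; apply: lreg1.
split.
  rewrite mlead_prod_proper //; apply/mnmP => i; rewrite mnm_sumE mnmE -sum1_count.
  rewrite [RHS]big_mkcond big_seq [RHS]big_seq; apply: eq_bigr => k /mu_n lek.
  by rewrite mlead_mesym // mnmE; case: ifP.
rewrite mleadc_prod_proper // big_seq big1 // => k /mu_n lek.
exact: mleadc_mesym.
Qed.
End Alternants.

(** * Conjugate partitions and the irreducible characters *)

Section ConjugatePartition.
Implicit Types s : seq nat.

Lemma geq_trans : transitive geq.
Proof. by move=> a b c leab lebc; apply: leq_trans lebc leab. Qed.

Lemma lt_count_sorted s i j : sorted geq s ->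
  (i < count (fun k => j < k)%N s)%N = (j < nth 0%N s i)%N.
Proof.
elim: s i => [|a s IHs] i s_sorted /=; first by rewrite nth_nil !ltn0.
have s_le : all (geq a) s by apply: order_path_min s_sorted; apply: geq_trans.
have [ltja|leaj] := ltnP j a.
  case: i => [|i] /=; first by rewrite ltja.
  by rewrite add1n ltnS IHs // (path_sorted s_sorted).
rewrite add0n (@eq_in_count _ _ pred0 s) => [|k /(allP s_le)]; last by rewrite /=; lia.
rewrite count_pred0 ltn0; apply/esym/negbTE; rewrite -leqNgt.
case: i => [|i] //=; have [lti|lei] := ltnP i (size s); last by rewrite nth_default.
by have /allP/(_ _ (mem_nth 0%N lti)) := s_le; rewrite /=; lia.
Qed.

Lemma sum_ltn a N : (a <= N)%N -> (\sum_(j < N) (j < a) = a)%N.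
Proof.
move=> leaN; rewrite -(big_mkord predT (fun j => (j < a) : nat)) (big_cat_nat (leq0n a) leaN) /=.
rewrite [X in (_ + X)%N]big_nat_cond [X in (_ + X)%N]big1 => [|j]; last by lia.
rewrite addn0 (eq_big_nat _ _ (F2 := fun=> 1%N)) => [|j /andP[_ ->] //].
by rewrite sum_nat_const_nat subn0 muln1.
Qed.

Lemma sum_count s N : all (fun k => k <= N)%N s ->
  (\sum_(j < N) count (fun k => j < k)%N s = sumn s)%N.
Proof.
elim: s => [|a s IHs] /=; first by rewrite big1.
by case/andP=> lea /IHs <-; rewrite big_split /= sum_ltn.
Qed.

Lemma size_conj_part s : size (conj_part s) = head 0%N s.
Proof. by rewrite size_map size_iota. Qed.

Lemma nth_conj_part s j : sorted geq s ->
  nth 0%N (conj_part s) j = count (fun k => j < k)%N s.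
Proof.
move=> s_sorted; have [ltj|lej] := ltnP j (head 0%N s).
  by rewrite (nth_map 0%N) ?size_iota // nth_iota.
rewrite nth_default ?size_conj_part //; apply/esym/eqP; rewrite -leqn0 leqNgt.
by rewrite lt_count_sorted // nth0 -leqNgt.
Qed.

Variable n : nat.
Implicit Types la : intpart n.+1.

Lemma intpartP la : [/\ sorted geq la, 0%N \notin (la : seq nat) & sumn la = n.+1].
Proof. by case: la => s /= /and3P[? ? /eqP]. Qed.

(** The conjugate partition, padded by zeros to one entry for each variable. *)
Definition conj_mnm la : 'X_{1..n.+1} :=
  [multinom count (fun k => i < k)%N la | i < n.+1].

Lemma intpart_le la : all (fun k => k <= n.+1)%N la.
Proof. by have /andP[_] := intpart_bounded la. Qed.

Lemma mdeg_conj_mnm la : mdeg (conj_mnm la) = n.+1.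
Proof.
have [_ _ la_n] := intpartP la; transitivity (sumn la) => //.
rewrite -(sum_count (intpart_le la)) mdegE.
by apply: eq_bigr => i _; rewrite mnmE.
Qed.

Lemma decreasing_conj_mnm la : decreasing (conj_mnm la).
Proof.
apply/decreasingP => i j leij; rewrite !mnmE; apply: sub_count => k /=.
exact: leq_ltn_trans.
Qed.

Lemma nth_conj_mnm la (i : 'I_n.+1) : conj_mnm la i = nth 0%N (conj_part la) i.
Proof. by have [la_s _ _] := intpartP la; rewrite mnmE nth_conj_part. Qed.

(** The part of index i is the number of j such that the entry of index j of the
conjugate exceeds i. *)
Lemma conj_mnm_inj : injective conj_mnm.
Proof.
have nthE la i : nth 0%N la i = (\sum_(j < n.+1) (i < conj_mnm la j))%N.
  have [la_s _ _] := intpartP la.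
  rewrite -[LHS](@sum_ltn _ n.+1).
    by apply: eq_bigr => j _; rewrite mnmE lt_count_sorted.
  have [lti|lei] := ltnP i (size la); last by rewrite nth_default.
  exact: (allP (intpart_le la) _ (mem_nth _ lti)).
have sizeE la : size la = conj_mnm la ord0.
  have [_ la0 _] := intpartP la; rewrite mnmE; apply/esym/eqP; rewrite -all_count.
  by apply/allP => k k_la; rewrite lt0n; apply: contraNneq la0 => <-.
move=> la la' eq_c; apply: val_inj; apply: (@eq_from_nth _ 0%N) => [|i _] /=.
  by rewrite !sizeE eq_c.
by rewrite !nthE eq_c.
Qed.

Lemma conj_mnm_surj ka : decreasing ka -> mdeg ka = n.+1 ->
  exists la, conj_mnm la = ka.
Proof.
move=> /decreasingP ka_d deg_ka.
have ka_s : sorted geq ka.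
  rewrite sorted_pairwise; last exact: geq_trans.
  apply/(pairwiseP 0%N) => i j; rewrite !inE size_tuple => lti ltj ltij.
  by have := ka_d (Ordinal lti) (Ordinal ltj) (ltnW ltij); rewrite !(mnm_nth 0%N).
have ka0 i : (ka i <= ka ord0)%N by apply: ka_d.
have ka0_le : (ka ord0 <= n.+1)%N.
  apply: (@leq_trans (mdeg ka)); last by rewrite deg_ka.
  by rewrite mdegE big_ord_recl leq_addr.
pose s := [seq count (fun k => j < k)%N ka | j <- iota 0 (ka ord0)].
have s_part : is_intpart n.+1 s.
  apply/and3P; split.
  - rewrite sorted_map sorted_pairwise; last by move=> a b c /=; apply: geq_trans.
    apply/(pairwiseP 0%N) => i j; rewrite !inE size_iota => lti ltj ltij.
    by rewrite !nth_iota //= !add0n; apply: sub_count => k /=; lia.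
  - apply/mapP => -[j]; rewrite mem_iota add0n => /= ltj /esym/eqP.
    rewrite -leqn0 leqNgt lt_count_sorted //.
    by rewrite -[nth _ _ _]/(nth 0%N ka (ord0 : 'I_n.+1)) -mnm_nth ltj.
  rewrite sumnE big_map -[X in iota 0 X]subn0 -/(index_iota 0 _) big_mkord.
  rewrite sum_count; last first.
    by apply/(all_nthP 0%N) => i; rewrite size_tuple => lti; have := ka0 (Ordinal lti); rewrite [X in (X <= _)%N](mnm_nth 0%N).
  by rewrite (sumn_mnm deg_ka).
exists (IntPart s_part); apply/mnmP => i; rewrite mnmE /= /s count_map.
rewrite -[RHS](sum_ltn (ka0 i)) -sum1_count -[X in iota 0 X]subn0 -/(index_iota 0 _) big_mkcond.
rewrite big_mkord; apply: eq_bigr => j _ /=.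
by rewrite lt_count_sorted // -mnm_nth; case: ifP.
Qed.

(** Empty blocks do not change the Young subgroup. *)
Lemma young_set_conj la : young_set n.+1 (conj_part la) = young_set n.+1 (conj_mnm la).
Proof.
have reshape_cat s t x : (x < sumn s)%N -> reshape_index (s ++ t) x = reshape_index s x.
  elim: s x => //= a s IHs x ltx; rewrite !reshape_index_cons.
  by case: ltnP => // leax; rewrite IHs //; lia.
have [la_s _ la_n] := intpartP la.
have hd_le : (head 0%N la <= n.+1)%N.
  by have := intpart_le la; case: (val la) => //= a s /andP[].
have catE : tval (multinom_val (conj_mnm la)) = conj_part la ++ nseq (n.+1 - head 0%N la) 0%N.
  apply: (@eq_from_nth _ 0%N) => [|i].
    by rewrite size_tuple size_cat size_nseq size_conj_part subnKC.
  rewrite size_tuple => lti; have := nth_conj_mnm la (Ordinal lti).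
  rewrite (mnm_nth 0%N) /= => ->; rewrite nth_cat size_conj_part.
  by case: ltnP => // lei; rewrite nth_nseq if_same nth_default ?size_conj_part.
have sum_c : sumn (conj_part la) = n.+1.
  have := sumn_mnm (mdeg_conj_mnm la).
  by rewrite catE sumn_cat sumn_nseq mul0n addn0.
apply/setP => g; rewrite !inE catE; apply/eq_forallb => x.
by rewrite !reshape_cat ?sum_c.
Qed.
End ConjugatePartition.

Section SpechtCharacters.
Variables (n : nat) (la : intpart n.+1).
Local Notation Sn := [set: 'S_n.+1].
Local Notation Z := {mpoly algC[n.+1]}.
Local Notation X := (fun i : 'I_n.+1 => 'X_i : Z).
Local Notation eta nu := ('Ind[Sn, young_group n.+1 nu] 1).
Local Notation eps m := ('Ind[Sn, young_group n.+1 m] (cfsign (young_group n.+1 m))).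
Local Notation lc := (conj_mnm la).

(** The Jacobi-Trudi determinant with multiplication read as induction product of
sign characters. *)
Definition det_char : 'CF(Sn) :=
  \sum_(s | jt_nonneg lc s) (-1) ^+ s *: eps (jt_exponent lc s).
Local Notation psi := det_char.

Lemma deg_jt s : jt_nonneg lc s -> mdeg (jt_exponent lc s) = n.+1.
Proof. by move=> ok; rewrite mdeg_jt_exponent ?mdeg_conj_mnm. Qed.

Lemma cfdot_det_triv nu : sumn nu = n.+1 -> '[psi, eta nu] =
  (alternant X (fun=> 0%N) * \prod_(k <- nu) elem X k)@_(staircase lc).
Proof.
move=> nu_n; rewrite mcoeff_alternant0 cfdot_suml; apply: eq_bigr => s ok.
by rewrite cfdotZl cfdot_sign_triv ?deg_jt.
Qed.

Lemma cfdot_det_sign nu : sumn nu = n.+1 -> '[psi, eps nu] =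
  (alternant X (fun=> 0%N) * \prod_(k <- nu) compl X k)@_(staircase lc).
Proof.
move=> nu_n; rewrite mcoeff_alternant0 cfdot_suml; apply: eq_bigr => s ok.
by rewrite cfdotZl cfdot_sign_sign ?deg_jt.
Qed.

(** The scalar product is a coefficient of a_delta times a Jacobi-Trudi determinant,
that is of a single alternant. *)
Lemma cfnorm_det_char : '[psi] = 1.
Proof.
have -> : '[psi] = \sum_(s | jt_nonneg lc s) (-1) ^+ s * '[psi, eps (jt_exponent lc s)].
  rewrite {2}/psi cfdot_sumr; apply: eq_bigr => s ok.
  by rewrite cfdotZr rmorph_sign.
transitivity ((alternant X lc)@_(staircase lc)).
  rewrite jacobi_trudi det_jt // mulr_sumr raddf_sum; apply: eq_bigr => s ok /=.
  rewrite (cfdot_det_sign (sumn_mnm (deg_jt ok))).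
  by rewrite mulrCA -(rmorph_sign (@mpolyC _ _)) mcoeffCM.
have la_d := decreasing_conj_mnm la.
by rewrite alternant_coef ?strict_staircase ?eqxx.
Qed.

(** The coefficient of e_la at an exponent not smaller than its leading one. *)
Lemma cfdot_jt_triv s : jt_nonneg lc s ->
  '[eps (jt_exponent lc s), eta la] = (s == 1%g)%:R.
Proof.
have [_ _ la_n] := intpartP la.
move=> ok; rewrite cfdot_sign_triv ?deg_jt //.
under eq_bigr => k _ do rewrite elem_mesym.
have [lead leadc] := mlead_mesyms algC (intpart_le la).
have [->|s1] := eqVneq s 1%g; first by rewrite jt_exponent1 -leadc lead.
by rewrite mcoeff_gt_mlead // lead jt_exponent_gt.
Qed.

Lemma char_eta nu : eta nu \is a character.
Proof. by rewrite cfInd_char ?rpred1. Qed.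

(** It is afforded by a representation of degree 1. *)
Lemma cfsign_char (G : {group 'S_n.+1}) : cfsign G \is a character.
Proof.
have repr_sign : mx_repr G (fun g : 'S_n.+1 => ((-1) ^+ odd_perm g)%:M : 'M[algC]_1).
  split=> [|g h _ _]; first by rewrite odd_perm1.
  by rewrite odd_permM signr_addb scalar_mxM.
have -> : cfsign G = cfRepr (MxRepresentation repr_sign).
  apply/cfun_inP => g g_in; rewrite cfsignE g_in cfunE g_in.
  by rewrite /= mxtrace_scalar.
exact: cfRepr_char.
Qed.

Lemma char_eps m : eps m \is a character.
Proof. by rewrite cfInd_char ?cfsign_char. Qed.

(** Since <Ind sgn, Ind 1> = 1 for the subgroups of la' and la, these two characters
have exactly one common constituent, with multiplicity 1 in Ind sgn.  The other
terms of the determinant are orthogonal to Ind 1_(S_la), so do not contain it.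
Hence the determinant has norm 1 and scalar product 1 with that constituent. *)
Lemma det_charE : psi = 'chi_(sym_Iirr la).
Proof.
have [_ _ la_n] := intpartP la.
have nat_dot (phi : 'CF(Sn)) i : phi \is a character -> '[phi, 'chi_i] \in Num.nat.
  by move=> phi_c; apply: Cnat_cfdot_char_irr.
have eq_eps1 : eps (jt_exponent lc 1%g) = eps lc by rewrite jt_exponent1.
have dot1 : '[eps lc, eta la] = 1.
  by rewrite -eq_eps1 cfdot_jt_triv ?jt_nonneg1 // eqxx.
have eps_conj : 'Ind[Sn, young_group n.+1 (conj_part la)] (cfsign _) = eps lc.
  have -> : young_group n.+1 (conj_part la) = young_group n.+1 lc.
    by apply: group_inj; apply: young_set_conj.
  by [].
have dotE m : '[eps m, eta la] = \sum_i '[eps m, 'chi_i] * '[eta la, 'chi_i].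
  rewrite {1}[eps m]cfun_sum_cfdot cfdot_suml; apply: eq_bigr => i _.
  rewrite cfdotZl; congr (_ * _).
  by rewrite cfdotC conj_natr ?nat_dot ?char_eta.
have term_ge0 m i : 0 <= '[eps m, 'chi_i] * '[eta la, 'chi_i].
  by rewrite mulr_ge0 // natr_ge0 // nat_dot ?char_eps ?char_eta.
have common_i : exists i, ('[eps lc, 'chi_i] != 0) && ('[eta la, 'chi_i] != 0).
  apply/existsP; apply: contraTT (oner_neq0 algC); rewrite negb_exists => /forallP none.
  rewrite negbK -dot1 dotE big1 // => i _; have := none i.
  by rewrite negb_and !negbK => /orP[] /eqP->; rewrite ?mul0r ?mulr0.
have i0_common : ('[eta la, 'chi_(sym_Iirr la)] != 0) &&
    ('[eps lc, 'chi_(sym_Iirr la)] != 0).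
  rewrite /sym_Iirr; case: pickP => [i|none].
    by rewrite eps_conj !inE.
  by have [i /andP[ei hi]] := common_i; have := none i; rewrite eps_conj !inE ei hi.
set i0 := sym_Iirr la in i0_common *; have {i0_common}/andP[eta0 eps0] := i0_common.
have nat_ge1 (a : algC) : a \in Num.nat -> a != 0 -> 1 <= a.
  by move=> /natrP[k ->]; rewrite pnatr_eq0 ler1n lt0n.
have eps1 : '[eps lc, 'chi_i0] = 1.
  apply/eqP; rewrite eq_le nat_ge1 ?nat_dot ?char_eps // andbT.
  rewrite -dot1 dotE (bigD1 i0) // ler_wpDr //.
    by apply: sumr_ge0 => i _; apply: term_ge0.
  by rewrite ler_peMr ?nat_ge1 ?natr_ge0 ?nat_dot ?char_eps ?char_eta.
have eps_other s : jt_nonneg lc s -> s != 1%g -> '[eps (jt_exponent lc s), 'chi_i0] = 0.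
  move=> ok s1; have := cfdot_jt_triv ok; rewrite (negbTE s1) dotE => /eqP.
  rewrite psumr_eq0 // => /allP/(_ i0); rewrite mem_index_enum => /(_ isT) /=.
  by rewrite mulf_eq0 (negbTE eta0) orbF => /eqP.
have psi_chi : '[psi, 'chi_i0] = 1.
  rewrite cfdot_suml (bigD1 1%g) ?jt_nonneg1 //= big1 => [|s /andP[ok s1]].
    by rewrite odd_perm1 expr0 scale1r addr0 eq_eps1.
  by rewrite cfdotZl eps_other ?mulr0.
apply/eqP; rewrite -subr_eq0 -cfnorm_eq0 cfnormB cfnorm_det_char cfnorm_irr psi_chi.
by rewrite conjC1 subrr.
Qed.

Lemma cfdot_irr_triv nu : sumn nu = n.+1 -> '['chi_(sym_Iirr la), eta nu] =
  (alternant X (fun=> 0%N) * \prod_(k <- nu) elem X k)@_(staircase lc).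
Proof. by rewrite -det_charE; apply: cfdot_det_triv. Qed.
End SpechtCharacters.

(** * Products of elementary polynomials in terms of alternants *)

Section Antisymmetric.
Variable n : nat.
Local Notation Z := {mpoly int[n.+1]}.
Local Notation X := (fun i : 'I_n.+1 => 'X_i : Z).
Implicit Types (m : 'X_{1..n.+1}) (D : Z).

Definition permute_mnm m (s : 'S_n.+1) : 'X_{1..n.+1} := [multinom m (s i) | i < n.+1].

Definition antisymmetric_poly D := forall s : 'S_n.+1, msym s D = (-1) ^+ s *: D.

Lemma antisymmetric_alternant m : antisymmetric_poly (alternant X m).
Proof.
move=> s; rewrite alternantE [msym s _]raddf_sum scaler_sumr.
rewrite [RHS](reindex_inj (mulgI (s^-1)%g)); apply: eq_bigr => t _ /=.
rewrite msymZ msymX scalerA -signr_addb odd_permM odd_permV addbA addbb addFb.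
by congr (_ *: 'X_[_]); apply/mnmP => i; rewrite !mnmE permM.
Qed.

Lemma sort_mnm m : injective m -> exists s, strict (permute_mnm m s).
Proof.
move=> m_inj; have [s def_t] : exists s : 'S_n.+1,
    sort geq m = [tuple tnth m (s i) | i < n.+1] :> seq nat.
  by apply/tuple_permP; rewrite perm_sort.
exists s; apply/strictP => i j ltij; rewrite !mnmE.
have t_sorted : sorted geq (sort geq m) by apply: sort_sorted => a b; apply: leq_total.
have nth_t k : nth 0%N (sort geq m) (k : 'I_n.+1) = m (s k).
  by rewrite def_t -tnth_nth tnth_mktuple -mnm_tnth.
have : (m (s j) <= m (s i))%N.
  rewrite -!nth_t; move: t_sorted; rewrite sorted_pairwise; last exact: geq_trans.
  by move/(pairwiseP 0%N)/(_ i j); apply; rewrite ?inE ?size_sort ?size_tuple.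
rewrite leq_eqVlt => /predU1P[/m_inj/perm_inj eq_ij|//].
by rewrite eq_ij ltnn in ltij.
Qed.

(** An exponent with two equal entries has coefficient 0 by antisymmetry, and any
other one can be sorted. *)
Lemma antisymmetric_eq0 D :
  antisymmetric_poly D -> (forall m, strict m -> D@_m = 0) -> D = 0.
Proof.
move=> D_anti D0; have D_perm m s : D@_(permute_mnm m s) = (-1) ^+ s * D@_m.
  by rewrite -mcoeffZ -D_anti mcoeff_sym.
apply/mpolyP => m; rewrite mcoeff0.
have [/injectiveP/sort_mnm[s ms]|] := boolP (injectiveb m).
  have := D0 _ ms; rewrite D_perm => /eqP; rewrite mulf_eq0 signr_eq0 /=.
  by move/eqP.
case/injectivePn => i [j neij eq_m]; have := D_perm m (tperm i j).
have -> : permute_mnm m (tperm i j) = m.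
  by apply/mnmP => k; rewrite mnmE; case: tpermP => [->|->|].
by rewrite odd_tperm neij mulN1r => eqD; lia.
Qed.

Lemma prod_mesym_sym (nu : seq nat) : \prod_(k <- nu) mesym n.+1 int k \is symmetric.
Proof. by apply: rpred_prod => k _; apply: mesym_sym. Qed.

Lemma prod_mesym_homog (nu : seq nat) :
  \prod_(k <- nu) mesym n.+1 int k \is (sumn nu).-homog.
Proof.
elim: nu => [|k nu IHnu]; first by rewrite big_nil dhomog1.
by rewrite big_cons /= dhomogM // dhomog_mesym.
Qed.

Lemma alternant_mnm0 : alternant X (fun=> 0%N) = alternant X (0%MM : 'X_{1..n.+1}).
Proof. by congr (\det _); apply/matrixP => i j; rewrite !mxE mnm0E. Qed.

Lemma alternant0_neq0 : alternant X (fun=> 0%N) != 0.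
Proof.
have d0 : decreasing (0%MM : 'X_{1..n.+1}) by apply/decreasingP => i j _; rewrite !mnm0E.
apply/eqP; rewrite alternant_mnm0 => /(congr1 (mcoeff (staircase 0%MM))).
rewrite (alternant_coef int d0 (strict_staircase d0)) eqxx mcoeff0.
by move/eqP; rewrite oner_eq0.
Qed.

(** The coefficient of the alternant of la' + delta in a_delta e_nu, a Kostka
number. *)
Definition kostka (nu : seq nat) (la : intpart n.+1) : int :=
  (alternant X (fun=> 0%N) * \prod_(k <- nu) elem X k)@_(staircase (conj_mnm la)).

Lemma strict_staircaseE m : strict m ->
  exists2 ka : 'X_{1..n.+1}, decreasing ka & m = staircase ka.
Proof.
move=> /strictP m_s; have m_ge : forall k (i : 'I_n.+1), (n - i = k)%N -> (k <= m i)%N.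
  elim=> // k IHk i ik; have lti : (i.+1 < n.+1)%N by lia.
  have := IHk (Ordinal lti); have := m_s i (Ordinal lti) (ltnSn _); rewrite /=; lia.
exists [multinom (m i - (n - i))%N | i < n.+1].
  apply/decreasingP => i j; rewrite !mnmE.
  rewrite leq_eqVlt => /predU1P[/val_inj->//|ltij].
  have step : forall k (j : 'I_n.+1), (i + k = j)%N -> (m j + k <= m i)%N.
    elim=> [|k IHk] j' ikj; first by rewrite addn0 (_ : j' = i) //; apply: val_inj; rewrite -[val j']ikj /= addn0.
    have ltk : (i + k < n.+1)%N by have := ltn_ord j'; lia.
    have := IHk (Ordinal ltk) erefl; have := m_s (Ordinal ltk) j'; rewrite /=; lia.
  have := step (j - i)%N j; have := ltn_ord j; lia.
by apply/mnmP => i; rewrite staircaseE mnmE subnK // m_ge.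
Qed.

Lemma mdeg_staircase (ka : 'X_{1..n.+1}) : mdeg (staircase ka) = (mdeg ka + mdeg (delta_mnm (1 : 'S_n.+1)))%N.
Proof. by rewrite /staircase mdegD. Qed.

Lemma alternant0_homog : alternant X (fun=> 0%N) \is (mdeg (delta_mnm (1 : 'S_n.+1))).-homog.
Proof.
rewrite alternant0E; apply: rpred_sum => s _; apply: rpredZ; rewrite dhomogX /=.
apply/eqP; rewrite !mdegE [RHS](reindex_inj (@perm_inj _ s)).
by apply: eq_bigr => i _; rewrite !mnmE perm1.
Qed.

(** Both sides times a_delta are antisymmetric, so it suffices to compare coefficients
at strictly decreasing exponents; in the right degree these are the la' + delta. *)
Lemma prod_elem_schur (nu : seq nat) : sumn nu = n.+1 ->
  \prod_(k <- nu) elem X k = \sum_la kostka nu la *: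
    \det (\matrix_(i < n.+1, j < n.+1)
       compl_int X ((conj_mnm la i)%:Z - i%:Z + j%:Z)).
Proof.
move=> nu_n; set f := \prod_(k <- nu) _.
have f_mesym : f = \prod_(k <- nu) mesym n.+1 int k.
  by apply: eq_bigr => k _; rewrite elem_mesym.
apply: (mulfI alternant0_neq0); rewrite mulr_sumr.
under [RHS]eq_bigr => la _ do rewrite -scalerAr -jacobi_trudi.
apply/eqP; rewrite -subr_eq0; apply/eqP/antisymmetric_eq0 => [s|m m_s].
  rewrite raddfB scalerBr; congr (_ - _).
    have a0 := antisymmetric_alternant 0%MM.
    have /issymP/(_ s) := prod_mesym_sym nu; rewrite -f_mesym => f_sym.
    by rewrite -[LHS]/(msym s (_ * f)) msymM alternant_mnm0 a0 f_sym -scalerAl.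
  rewrite [LHS]raddf_sum scaler_sumr; apply: eq_bigr => la _ /=.
  by rewrite msymZ antisymmetric_alternant !scalerA mulrC.
have [ka ka_d def_m] := strict_staircaseE m_s.
rewrite mcoeffB raddf_sum /=.
under eq_bigr => la _ do rewrite mcoeffZ alternant_coef ?decreasing_conj_mnm //.
have [deg_ka|deg_ka] := eqVneq (mdeg ka) n.+1.
  have [la def_ka] := conj_mnm_surj ka_d deg_ka.
  rewrite (bigD1 la) //= big1 => [|la' neq].
    by rewrite def_m -def_ka eqxx mulr1 addr0 subrr.
  case: eqP => [eq_m|]; last by rewrite mulr0.
  case/eqP: neq; apply: conj_mnm_inj; rewrite def_ka; apply: (@addIm _ (delta_mnm 1)).
  by rewrite -/(staircase _) -eq_m def_m.
rewrite (dhomog_nemf_coeff (mf := mdeg) (d := (mdeg (delta_mnm (1 : 'S_n.+1)) + n.+1)%N)).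
- rewrite big1 ?subrr // => la _; case: eqP => [eq_m|]; last by rewrite mulr0.
  have := congr1 mdeg eq_m; rewrite def_m !mdeg_staircase mdeg_conj_mnm => /eqP.
  by rewrite eqn_add2r (negbTE deg_ka).
- have f_homog := prod_mesym_homog nu; rewrite -f_mesym nu_n in f_homog.
  exact: dhomogM alternant0_homog f_homog.
by rewrite def_m -[X in X != _]/(mdeg (staircase ka)) mdeg_staircase addnC eqn_add2l.
Qed.
End Antisymmetric.

(** * Transfer to arbitrary sequences *)

Section DeterminantPadding.
Variables (B : comNzRingType) (e : int -> B).
Hypotheses (e0 : e 0 = 1) (eN : forall k, e (Negz k) = 0).

(** Each additional row is 0, ..., 0, 1. *)
Lemma det_pad (s : seq nat) N : (size s <= N)%N ->
  \det (\matrix_(i < N, j < N) e ((nth 0%N s i)%:Z - i%:Z + j%:Z)) =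
  \det (\matrix_(i < size s, j < size s) e ((nth 0%N s i)%:Z - i%:Z + j%:Z)).
Proof.
move/subnKC<-; elim: (N - size s)%N => [|k IHk]; first by rewrite addn0.
rewrite addnS -{}IHk; set N' := (size s + k)%N.
rewrite (expand_det_row _ ord_max) (bigD1 ord_max) //= big1 => [|j neq].
  rewrite addr0 mxE nth_default ?leq_addr //= sub0r addrC subrr e0 mul1r.
  rewrite /cofactor addnn -signr_odd odd_double mul1r; congr (\det _).
  by apply/matrixP => i j; rewrite !mxE !lift_max.
rewrite mxE nth_default ?leq_addr //=.
have ltj : (j < N')%N by have := ltn_ord j; rewrite ltnS leq_eqVlt -val_eqE /= in neq * ; rewrite (negbTE neq).
have -> : (0 - N'%:Z + j%:Z) = Negz (N' - j).-1 by lia.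
by rewrite eN mul0r.
Qed.
End DeterminantPadding.

Section Transfer.
Variable n : nat.
Local Notation Z := {mpoly int[n.+1]}.
Local Notation X := (fun i : 'I_n.+1 => 'X_i : Z).

Lemma kostka_algC (nu : seq nat) (la : intpart n.+1) :
  (alternant (fun i : 'I_n.+1 => 'X_i : {mpoly algC[n.+1]}) (fun=> 0%N) *
   \prod_(k <- nu) elem (fun i : 'I_n.+1 => 'X_i : {mpoly algC[n.+1]}) k)
     @_(staircase (conj_mnm la)) = (kostka nu la)%:~R.
Proof.
rewrite /kostka -(mcoeff_map_mpoly intr) rmorphM rmorph_prod; congr ((_ * _)@__).
  rewrite !alternant0E [RHS]raddf_sum; apply: eq_bigr => s _ /=.
  by rewrite map_mpolyZ map_mpolyX rmorph_sign.
apply: eq_bigr => k _; rewrite !elem_mesym /mesym rmorph_sum; apply: eq_bigr => h _.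
by rewrite rmorph_prod; apply: eq_bigr => i _; rewrite /= map_mpolyX.
Qed.

(** The polynomial variables stand for the elementary symmetric polynomials. *)
Definition formal_elem (k : nat) : Z :=
  if k is k'.+1 then if (k' < n.+1)%N then 'X_(inord k') else 0 else 1.
Definition formal_compl (k : nat) : Z :=
  inv_seq (fun i => (-1) ^+ i * formal_elem i) k.
Definition formal_compl_int (a : int) : Z := if a is Posz k then formal_compl k else 0.

Local Notation S := [tuple mesym n.+1 int i.+1 | i < n.+1].

Lemma formal_elem_mesym k : formal_elem k \mPo S = elem X k.
Proof.
rewrite elem_mesym; case: k => [|k] /=; first by rewrite rmorph1 mesym0E.
case: ifP => ltk; last by rewrite rmorph0 mesym_geqnE // ltnNge ltk.
by rewrite comp_mpolyXU -tnth_nth tnth_mktuple inordK.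
Qed.

Lemma formal_compl_mesym k : formal_compl k \mPo S = compl X k.
Proof.
rewrite /formal_compl /compl (rmorph_inv_seq (comp_mpoly S)).
apply: eq_inv_seq => i _ /=; rewrite rmorphM rmorph_sign /= formal_elem_mesym.
by rewrite /elem mulrA -expr2 sqrr_sign mul1r.
Qed.

Lemma size_conj_part_le (la : intpart n.+1) : (size (conj_part la) <= n.+1)%N.
Proof.
by rewrite size_conj_part; have := intpart_le la; case: (val la) => //= a s /andP[].
Qed.

(** The determinants have to be reduced to their natural size before the algebraic
independence is used: only then do all their indices stay within the number of
variables, which [prod_compl_schur] needs. *)
Lemma prod_formal_elem (nu : seq nat) : sumn nu = n.+1 ->
  \prod_(k <- nu) formal_elem k = \sum_(la : intpart n.+1) kostka nu la *:
    \det (\matrix_(i < size (conj_part la), j < size (conj_part la))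
       formal_compl_int ((nth 0%N (conj_part la) i)%:Z - i%:Z + j%:Z)).
Proof.
move=> nu_n; apply: (@msym_fundamental_un n.+1 int).
rewrite rmorph_prod raddf_sum /=.
under eq_bigr => k _ do rewrite formal_elem_mesym.
rewrite prod_elem_schur //; apply: eq_bigr => la _.
rewrite comp_mpolyZ -(det_map_mx (comp_mpoly S)); congr (_ *: _).
have nth_s i := nth_conj_mnm la i.
transitivity (\det (\matrix_(i < n.+1, j < n.+1)
    compl_int X ((nth 0%N (conj_part la) i)%:Z - i%:Z + j%:Z))).
  by congr (\det _); apply/matrixP => i j; rewrite !mxE nth_s.
have c0 : compl_int X 0 = 1 := inv_seq0 _.
rewrite (det_pad c0 (fun=> erefl) (size_conj_part_le la)); congr (\det _).
apply/matrixP => i j; rewrite !mxE; case: (_ + _) => k /=; last by rewrite rmorph0.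
by rewrite formal_compl_mesym.
Qed.

(** Evaluation of [prod_formal_elem] with the roles of e and h exchanged.  The entries
of the determinant have index at most la'_0 + la_0 - 1, a hook length, hence at most
n + 1, the range in which the formal sequences have the required values. *)
Lemma prod_compl_schur (B : comNzRingType) (h : nat -> B) (e : int -> B) (nu : seq nat) :
    h 0%N = 1 -> (forall k, e (Negz k) = 0) ->
    (forall k, (k <= n.+1)%N -> e k%:Z = inv_seq (fun i => (-1) ^+ i * h i) k) ->
    sumn nu = n.+1 ->
  \prod_(k <- nu) h k = \sum_(la : intpart n.+1) (kostka nu la)%:~R *
    \det (\matrix_(i < size (conj_part la), j < size (conj_part la))
       e ((nth 0%N (conj_part la) i)%:Z - i%:Z + j%:Z)).
Proof.
move=> h0 eN eh nu_n.
pose phi : {mpoly int[n.+1]} -> B := mmap intr (fun i : 'I_n.+1 => h i.+1).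
have phi_elem k : (k <= n.+1)%N -> phi (formal_elem k) = h k.
  case: k => [|k] lek /=; first by rewrite h0 /phi rmorph1.
  by rewrite lek /phi mmapX mmap1U inordK.
have phi_compl k : (k <= n.+1)%N -> phi (formal_compl k) = e k%:Z.
  move=> lek; rewrite eh // /formal_compl /phi.
  rewrite (rmorph_inv_seq (mmap intr (fun i : 'I_n.+1 => h i.+1))).
  apply: eq_inv_seq => i lei /=; rewrite rmorphM rmorph_sign /=; congr (_ * _).
  by apply: phi_elem; apply: leq_trans lek.
have := congr1 phi (prod_formal_elem nu_n).
rewrite {1}/phi rmorph_prod big_seq => lhs.
transitivity (\prod_(k <- nu | k \in nu) phi (formal_elem k)).
  rewrite big_seq; apply: eq_bigr => k k_nu; rewrite phi_elem //.
  rewrite -nu_n; elim: (nu) k_nu {lhs} => //= l nu' IH.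
  by rewrite inE => /predU1P[->|/IH]; lia.
rewrite lhs /phi raddf_sum; apply: eq_bigr => la _ /=.
rewrite mmapZ; congr (_ * _).
rewrite -(det_map_mx (mmap intr (fun i : 'I_n.+1 => h i.+1))); congr (\det _).
apply/matrixP => i j; rewrite !mxE.
have [la_s la0 la_n] := intpartP la.
have hook : (size (conj_part la) + size la <= (sumn la).+1)%N.
  rewrite size_conj_part; move: la0; case: (val la) => //= a s.
  rewrite inE negb_or => /andP[_ s0].
  suff : (size s <= sumn s)%N by lia.
  elim: s s0 => //= b s IHs; rewrite inE negb_or => /andP[b0 /IHs].
  by rewrite eq_sym -lt0n in b0; lia.
have le_size : (nth 0%N (conj_part la) i <= size la)%N.
  by rewrite nth_conj_part // count_size.
case def_k: (_ + _) => [k|k] /=; last by rewrite eN /phi rmorph0.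
by apply: phi_compl; rewrite la_n in hook; have := ltn_ord i; have := ltn_ord j; lia.
Qed.
End Transfer.

(** * The supersymmetric functions and the Frobenius formula *)

Section SuperSeries.
Variables (K : fieldType) (m n : nat) (x : 'I_m -> K) (y : 'I_n -> K).
Local Notation lin z := (1 - z%:P * 'X).

(** The complete supersymmetric functions, with generating series
prod_j (1 - y_j u) / prod_i (1 - x_i u). *)
Definition super_h (k : nat) : K :=
  series_quot (\prod_(j < n) lin (y j)) (\prod_(i < m) lin (x i)) k.

Lemma series_quot_trunc (P Q : {poly K}) N : Q`_0 != 0 ->
  eqX N (Q * \poly_(i < N) series_quot P Q i) P.
Proof.
move=> Q0 k ltkN; rewrite -(series_quotP P k Q0) coefMr.
apply: eq_bigr => i _; have ltik := ltn_ord i.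
by rewrite coef_poly ifT //; lia.
Qed.

Lemma prod_lin0 d (z : 'I_d -> K) : (\prod_(i < d) lin (z i))`_0 = 1.
Proof.
rewrite -horner_coef0 horner_prod big1 // => i _.
by rewrite !hornerE ?mulr0 ?subr0.
Qed.

Lemma prod_lin_scale d (z : 'I_d -> K) c :
  \prod_(i < d) lin (z i) \Po (c%:P * 'X) = \prod_(i < d) lin (z i * c).
Proof.
rewrite rmorph_prod; apply: eq_bigr => i _ /=.
by rewrite rmorphB rmorph1 rmorphM /= comp_polyC comp_polyX polyCM mulrA.
Qed.

Lemma series_quot0 (P Q : {poly K}) : P`_0 = 1 -> Q`_0 = 1 -> series_quot P Q 0 = 1.
Proof.
move=> P0 Q0; have := @series_quotP _ P Q 0; rewrite Q0 oner_eq0 => /(_ isT).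
by rewrite big_ord1 mul1r P0.
Qed.

Lemma super_h0 : super_h 0 = 1.
Proof. by rewrite /super_h series_quot0 ?prod_lin0. Qed.

(** Replacing t by -t exchanges numerator and denominator of the two generating
series. *)
Lemma super_e_inv k :
  super_e x y k = inv_seq (fun i => (-1) ^+ i * super_h i) k.
Proof.
pose N := k.+1; pose hp : {poly K} := \poly_(i < N) super_h i.
pose ep : {poly K} := \poly_(i < N) super_e x y i.
have EE d (z : 'I_d -> K) : \prod_(i < d) (1 + (z i)%:P * 'X) =
    \prod_(i < d) lin (z i) \Po ((-1)%:P * 'X).
  by rewrite prod_lin_scale; apply: eq_bigr => i _; rewrite mulrN1 polyCN mulNr opprK.
have E0 d (z : 'I_d -> K) : (\prod_(i < d) (1 + (z i)%:P * 'X))`_0 = 1.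
  by rewrite EE coef_comp_scaleX expr0 mul1r prod_lin0.
have h_rel := series_quot_trunc (\prod_(j < n) lin (y j)) (N := N) (_ : (\prod_(i < m) lin (x i))`_0 != 0).
rewrite prod_lin0 oner_eq0 in h_rel; have {h_rel} := eqX_scale (-1) (h_rel isT).
rewrite rmorphM /= -!EE -/hp => h_rel.
have e_rel := series_quot_trunc (\prod_(i < m) (1 + (x i)%:P * 'X)) (N := N)
  (_ : (\prod_(j < n) (1 + (y j)%:P * 'X))`_0 != 0).
rewrite E0 oner_eq0 in e_rel; move/(_ isT) in e_rel.
set a := hp \Po _ in h_rel.
have a0 : a`_0 = 1 by rewrite /a coef_comp_scaleX expr0 mul1r coef_poly super_h0.
have ae1 : eqX N (a * ep) 1.
  apply: (eqX_cancel (E0 _ x)) => i ltiN; rewrite mulrA.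
  by rewrite (eqX_mul h_rel (fun _ _ => erefl) ltiN) e_rel // mulr1.
have := inv_seq_unique a0 ae1 (ltnSn k); rewrite coef_poly ltnSn => ->.
by apply: eq_inv_seq => i lei; rewrite /a coef_comp_scaleX coef_poly ltnS lei.
Qed.

Variable q : K.
Hypotheses (q0 : q != 0) (q2_neq1 : q ^+ 2 != 1).

Definition super_g (k : nat) : K := q ^+ k / (q - q^-1) * super_q x y (q ^- 2) k.

(** For H(u) = sum_k h_k u^k, the series sum_k q_k(x/y; c) u^k is H(u) / H(c u). *)
Lemma super_h_rec c k : (1 - c ^+ k.+1) * super_h k.+1 =
  \sum_(j < k.+1) c ^+ (k - j) * super_h (k - j) * super_q x y c j.+1.
Proof.
pose N := k.+2; pose hp : {poly K} := \poly_(i < N) super_h i.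
pose Px := \prod_(i < m) lin (x i); pose Py := \prod_(j < n) lin (y j).
pose Pxc := \prod_(i < m) lin (x i * c); pose Pyc := \prod_(j < n) lin (y j * c).
pose Q : {poly K} := \poly_(i < N) super_q x y c i.
have Px0 : Px`_0 != 0 by rewrite prod_lin0 oner_eq0.
have D0 : (Px * Pyc)`_0 = 1 by rewrite coef0M !prod_lin0 mulr1.
have h_rel : eqX N (Px * hp) Py by apply: series_quot_trunc.
have hc_rel : eqX N (Pxc * (hp \Po (c%:P * 'X))) Pyc.
  have := eqX_scale c h_rel.
  by rewrite rmorphM /= !prod_lin_scale.
have q_rel : eqX N (Px * Pyc * Q) (Pxc * Py).
  by apply: series_quot_trunc; rewrite D0 oner_eq0.
have key : eqX N hp ((hp \Po (c%:P * 'X)) * Q).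
  apply: (eqX_cancel D0) => i ltiN.
  have -> : Px * Pyc * hp = Px * hp * Pyc by ring.
  rewrite (eqX_mul h_rel (fun _ _ => erefl) ltiN).
  have -> : Px * Pyc * ((hp \Po (c%:P * 'X)) * Q) = (hp \Po (c%:P * 'X)) * (Px * Pyc * Q) by ring.
  rewrite (eqX_mul (fun _ _ => erefl) q_rel ltiN).
  have -> : (hp \Po (c%:P * 'X)) * (Pxc * Py) = Pxc * (hp \Po (c%:P * 'X)) * Py by ring.
  by rewrite (eqX_mul hc_rel (fun _ _ => erefl) ltiN) mulrC.
have q00 : super_q x y c 0 = 1.
  by rewrite /super_q series_quot0 ?coef0M ?prod_lin0 ?mulr1.
have := key k.+1 (ltnSn _); rewrite coefMr coef_poly ltnSn big_ord_recl /= subn0.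
rewrite coef_comp_scaleX !coef_poly ltnSn /= q00 mulr1 mulrBl mul1r => key1.
rewrite {1}key1 addrAC subrr add0r; apply: eq_bigr => j _; have ltj := ltn_ord j.
rewrite /bump /= add1n subSS coef_comp_scaleX !coef_poly !ifT //; lia.
Qed.

Lemma super_hg k : qint q k.+1 * super_h k.+1 =
  \sum_(j < k.+1) q ^+ j * (super_h (k - j) * super_g j.+1).
Proof.
have d0 : q ^+ 2 - 1 != 0 by rewrite subr_eq0.
have qq : q - q^-1 = (q ^+ 2 - 1) / q by rewrite mulrBl mul1r expr2 mulfK.
apply: (mulfI d0); rewrite mulrA.
have -> : (q ^+ 2 - 1) * qint q k.+1 = q ^+ (2 * k.+1) - 1.
  elim: (k.+1) => [|l IHl]; first by rewrite /qint big_ord0 mulr0 muln0 subrr.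
  rewrite /qint big_ord_recr mulrDr -/(qint q l) IHl mulnS exprD /=; ring.
have -> : (q ^+ (2 * k.+1) - 1) = q ^+ (2 * k.+1) * (1 - (q ^- 2) ^+ k.+1).
  by rewrite mulrBr mulr1 exprVn exprM mulfV // expf_neq0 // expf_neq0.
rewrite -mulrA super_h_rec !mulr_sumr; apply: eq_bigr => j _.
have lejk : (j <= k)%N by have := ltn_ord j; lia.
have -> : (2 * k.+1 = 2 * (k - j) + 2 * j.+1)%N by lia.
rewrite /super_g qq invf_div exprVn exprD -!exprM.
have : q ^+ (2 * (k - j)) != 0 by rewrite expf_neq0.
rewrite (_ : q ^+ (2 * j.+1) = q ^+ j * q ^+ j.+1 * q); last first.
  by rewrite -exprD -exprSr; congr (_ ^+ _); lia.
move: (q ^+ (2 * (k - j))) (q ^+ j) (q ^+ j.+1) (super_h _) (super_q _ _ _ _) => a b c h s a0.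
field; by rewrite d0 a0.
Qed.

Lemma prod_super_g (mu : seq nat) : \prod_(k <- mu) super_g k =
  q ^+ sumn mu / (q - q^-1) ^+ size mu * super_q_part x y (q ^- 2) mu.
Proof.
rewrite /super_q_part; elim: mu => [|k mu IHmu].
  by rewrite !big_nil !expr0 invr1 !mulr1.
rewrite !big_cons IHmu /super_g /= exprD [in RHS](exprS (q - q^-1)).
rewrite (invfM (q - q^-1)).
by rewrite mulrACA; congr (_ * _); rewrite mulrACA.
Qed.
End SuperSeries.

Section Transcendence.
Variables m n : nat.

Lemma Kxy_q_transcendental (p : {poly int}) :
  (map_poly intr p).[Kxy_q m n] = 0 -> p = 0.
Proof.
pose f : {rmorphism {poly rat} -> Kxy m n} :=
  (@FracField.tofrac {mpoly Qq[m + n]} \o (@mpolyC (m + n) Qq) \o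
   @FracField.tofrac {poly rat}) : {rmorphism _ -> _}.
have f_eq0 (u : {poly rat}) : f u = 0 -> u = 0.
  by move/eqP; rewrite /f /= tofrac_eq0 mpolyC_eq0 tofrac_eq0 => /eqP.
have -> : (map_poly intr p).[Kxy_q m n] = f (map_poly intr p : {poly rat}).
  have -> : map_poly intr p = map_poly f (map_poly intr p) :> {poly Kxy m n}.
    by rewrite -map_poly_comp; apply: eq_map_poly => k; rewrite [RHS](rmorph_int f).
  rewrite -[Kxy_q m n]/(f 'X) horner_map; congr (f _).
  have -> : map_poly intr p = map_poly polyC (map_poly intr p) :> {poly {poly rat}}.
    by rewrite -map_poly_comp; apply: eq_map_poly => k; rewrite [RHS](rmorph_int polyC).
  exact: comp_polyXr.
move/f_eq0 => p0; apply: (@map_inj_poly _ _ (intr : int -> rat) intr_inj) => //.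
by rewrite p0 map_poly0.
Qed.
End Transcendence.

Section HeckeFrobenius.
Variables (K : fieldType) (q : K) (n : nat).
Hypothesis q_trans : forall p : {poly int}, (map_poly intr p).[q] = 0 -> p = 0.
Variables (H : algType K) (T : 'I_n.+1.-1 -> H).
Hypothesis relT : hecke_relations q T.
Variable chi : intpart n.+1 -> H -> K.
Hypothesis chi_irr : forall la, is_hecke_irr_char q T la (chi la).
Variables (a b : nat) (x : 'I_a -> K) (y : 'I_b -> K).

Definition frobenius_trace (h : H) : K^o :=
  \sum_(la : intpart n.+1) chi la h * super_schur x y la.

Fact frobenius_trace_linear : linear frobenius_trace.
Proof.
move=> c h h'; rewrite /frobenius_trace scaler_sumr -big_split.
apply: eq_bigr => la _; have [[d [rho [_ chiE]]] _] := chi_irr la.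
by rewrite !chiE linearP /= mxtraceD mxtraceZ mulrDl -mulrA.
Qed.
HB.instance Definition _ :=
  GRing.isLinear.Build K H K^o _ frobenius_trace frobenius_trace_linear.

Lemma frobenius_traceC h h' : frobenius_trace (h * h') = frobenius_trace (h' * h).
Proof.
apply: eq_bigr => la _; have [[d [rho [_ chiE]]] _] := chi_irr la.
by rewrite !chiE !rmorphM -!mulmxE mxtrace_mulC.
Qed.

(** The values of the characters at the idempotents are the coefficients in the
expansion of h_nu. *)
Lemma frobenius_trace_idems nu : sumn nu = n.+1 ->
  frobenius_trace (sym_idems q (nat_gen T) 0 nu) = \prod_(k <- nu) super_h x y k.
Proof.
move=> nu_n; rewrite (@prod_compl_schur n K _ (super_e_int x y)) //.
- apply: eq_bigr => la _.
  have [N -> valN] := hecke_char_sym_idems nu_n q_trans relT (chi_irr la).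
  congr (_ * _); rewrite cfdot_irr_triv // kostka_algC in valN.
  have <- : N%:Z = kostka nu la by apply: (@intr_inj algC); rewrite -valN.
  by [].
- exact: super_h0.
by move=> k _; apply: super_e_inv.
Qed.

Lemma hecke_cycle_chain c k : (c + k <= n.+1)%N ->
  hecke_cycle T c k = chain (nat_gen T) c k.-1.
Proof.
move=> lec; rewrite /hecke_cycle.
transitivity (\prod_(0 <= i < n | (c <= i < c + k.-1)%N) nat_gen T i).
  rewrite big_mkord; apply: eq_bigr => i _; rewrite /nat_gen.
  by case: insubP => [j _ /val_inj-> //|]; rewrite ltn_ord.
have [k1|k1] := leqP k 1.
  have -> : k.-1 = 0%N by lia.
  by rewrite big_pred0 // => i; lia.
rewrite -(big_nat_widen _ _ _ (fun i => (c <= i)%N)); last by lia.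
rewrite -(big_nat_widenl _ _ _ predT) //.
elim: k.-1 c {lec k1} => [|l IHl] c /=; first by rewrite addn0 big_geq.
by rewrite big_ltn ?addnS ?ltnS ?leq_addr // -addSn IHl.
Qed.

Lemma hecke_gamma_chains mu : sumn mu = n.+1 ->
  hecke_gamma T mu = chains (nat_gen T) 0 mu.
Proof.
move=> mu_n; rewrite /hecke_gamma.
suff gen c nu : (c + sumn nu <= n.+1)%N ->
    \prod_(0 <= i < size nu) hecke_cycle T (c + sumn (take i nu)) (nth 0%N nu i) =
    chains (nat_gen T) c nu.
  by rewrite -gen ?mu_n //; apply: eq_bigr.
elim: nu c => [|k nu IHnu] c /=; first by rewrite big_geq.
move=> lec; rewrite big_nat_recl //= addn0 hecke_cycle_chain; last by lia.
congr (_ * _); rewrite -IHnu; last by lia.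
by apply: eq_bigr => i _; rewrite addnA.
Qed.

Lemma frobenius_formula (mu : intpart n.+1) :
  q ^+ sumn mu / (q - q^-1) ^+ size mu * super_q_part x y (q ^- 2) mu =
  \sum_(la : intpart n.+1) chi la (hecke_gamma T mu) * super_schur x y la.
Proof.
have [_ mu0 mu_n] := intpartP mu.
have q0 := trans_neq0 q_trans; have qint0 := trans_qint_neq0 q_trans.
have q2 : q ^+ 2 != 1.
  apply/eqP => q2; have := @q_trans ('X^2 - 1).
  rewrite rmorphB rmorph1 /= map_polyXn !hornerE q2 subrr => /(_ erefl)/eqP.
  by rewrite -size_poly_eq0 size_XnsubC.
rewrite -prod_super_g hecke_gamma_chains // -/(frobenius_trace _).
have FC i h : (i.+1 < n.+1)%N ->
    frobenius_trace (nat_gen T i * h) = frobenius_trace (h * nat_gen T i).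
  by move=> _; apply: frobenius_traceC.
have h_rec k : (k < n.+1)%N -> qint q k.+1 *: (super_h x y k.+1 : K^o) =
    \sum_(j < k.+1) q ^+ j *: (super_h x y (k - j) * super_g x y q j.+1 : K^o).
  by move=> _; apply: super_hg.
have of_idems nu : sumn nu = n.+1 ->
    block_trace q (nat_gen T) frobenius_trace nu [::] = \prod_(k <- nu) super_h x y k.
  by move=> nu_n; rewrite /block_trace /= mulr1 frobenius_trace_idems.
have := block_trace_of_idems (B := K^o) q0 (hecke_relations_nat relT) qint0 FC
  (super_h0 x y) h_rec of_idems (nu := [::]) mu0 mu_n.
by rewrite /block_trace /= mul1r big_nil mul1r.
Qed.
End HeckeFrobenius.

Unset Implicit Arguments.

Theorem theorem5p5 (m n r : nat) (mn_gt0 : (0 < m + n)%N) (r_gt0 : (0 < r)%N)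
    (H : algType (Kxy m n)) (T : 'I_r.-1 -> H)
    (H_hecke : is_hecke_algebra (Kxy_q m n) T)
    (chi : intpart r -> H -> Kxy m n)
    (chi_irr : forall la : intpart r,
       is_hecke_irr_char (Kxy_q m n) T la (chi la))
    (mu : intpart r) :
  let q := Kxy_q m n in
  q ^+ sumn mu / (q - q^-1) ^+ size mu
    * super_q_part (@Kxy_x m n) (@Kxy_y m n) (q ^- 2) mu
  = \sum_(la : intpart r)
      chi la (hecke_gamma T mu) * super_schur (@Kxy_x m n) (@Kxy_y m n) la.
Proof.
case: r r_gt0 H T H_hecke chi chi_irr mu => [//|r] _ H T [relT _] chi chi_irr mu q.
exact: (frobenius_formula (@Kxy_q_transcendental m n) relT chi_irr).
Qed.
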